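(* Let $\phi:G\times Q\to Q$ be a free and proper action of a Lie group $G$ such that $\eta=\Pi^*(dt)$ is $G$-invariant, and let $h:V^*\Pi\to T^*Q$ be a $G$-equivariant Hamiltonian section of $\mu$. Let $\xi\in\mathfrak g$ and let $\widehat\xi_Q:T^*Q\to\mathbb R$, $\widehat\xi_Q(\alpha_q)=\alpha_q(\xi_Q(q))$, be the fiberwise linear function induced by $\xi_Q\in\mathfrak X(Q)$. Then: (i) The smooth function $\widehat\xi_Q-c_\phi(\xi)F_h:T^*Q\to\mathbb R$ is $\mu$-basic, and the corresponding function on $V^*\Pi$ is $J^V_\xi$. (ii) $J^V_\xi$ is a first integral of the time-dependent Hamiltonian dynamics $R_h$, i.e. $R_h(J^V_\xi)=0$.
   Context: Setting: $Q$ is a connected smooth manifold of dimension $n+1$, $\Pi:Q\to\mathbb R$ is a fibration (surjective submersion), $\eta=\Pi^*(dt)\in\Omega^1(Q)$, and $V\Pi=\{u\in TQ\mid \eta(u)=0\}$ is the vertical bundle, with dual bundle $V^*\Pi$ and bundle projection $\tau:V^*\Pi\to Q$. $\mu:T^*Q\to V^*\Pi$ is the dual of the inclusion $V\Pi\hookrightarrow TQ$ (restriction of covectors to $V\Pi$); it is a principal $\mathbb R$-bundle with action $\psi(s,\alpha_q)=\alpha_q+s\,\eta(q)$. A function on $T^*Q$ is $\mu$-basic if it is of the form $f\circ\mu$ with $f$ smooth on $V^*\Pi$. $\omega_Q=-d\lambda_Q$ is the canonical symplectic form on $T^*Q$ ($\lambda_Q$ the Liouville 1-form), and $i_X\omega=\omega(X,\cdot)$.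 A Hamiltonian section is a smooth section $h:V^*\Pi\to T^*Q$ of $\mu$. Its extended Hamiltonian function $F_h:T^*Q\to\mathbb R$ is determined by $\alpha_q-h(\mu(\alpha_q))=F_h(\alpha_q)\eta(q)$ for all $\alpha_q\in T^*_qQ$. Put $\Omega_h=h^*\omega_Q$. $R_h\in\mathfrak X(V^*\Pi)$ is the unique vector field with $i_{R_h}\Omega_h=0$ and $\eta_1(R_h)=1$, where $\eta_1=\tau^*\eta$. Group actions: $\mathfrak g$ is the Lie algebra of $G$. $T^*\phi$ is the cotangent lift, $(T_g^*\phi(\alpha_q))(u)=\alpha_q(T_{\phi_g(q)}\phi_{g^{-1}}(u))$ for $u\in T_{\phi_g(q)}Q$; when $\eta$ is $G$-invariant ($\phi_g^*\eta=\eta$ for all $g$), $V^*\phi$ is the action on $V^*\Pi$ given by the same formula for $u\in V_{\phi_g(q)}\Pi$. $\xi_Q$ is the infinitesimal generator of $\xi\in\mathfrak g$ on $Q$. $h$ is $G$-equivariant if $T_g^*\phi\circ h=h\circ V_g^*\phi$ for all $g\in G$. $G$-invariance of $\eta$ gives a smooth function $m:G\to\mathbb R$ with $m(gh)=m(g)+m(h)$ and $\Pi\circ\phi_g=\Pi+m(g)$; put $c_\phi=dm(e)\in\mathfrak g^*$. Momentum maps: $J:T^*Q\to\mathfrak g^*$ is $J(\alpha_q)(\xi)=\alpha_q(\xi_Q(q))-F_h(\alpha_q)c_\phi(\xi)$, and $J^V:V^*\Pi\to\mathfrak g^*$ is the smooth map induced by $J$, characterized by $J=J^V\circ\mu$;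 $J^V_\xi(\beta)=J^V(\beta)(\xi)$. *)

(* Defs.v *)
From HB Require Import structures.
From mathcomp Require Import all_boot all_order all_algebra.
From mathcomp Require Import all_classical all_reals all_analysis.
Set Implicit Arguments.
Unset Strict Implicit.
Unset Printing Implicit Defensive.
Import Order.TTheory GRing.Theory Num.Theory numFieldNormedType.Exports.
Local Open Scope classical_set_scope.
Local Open Scope ring_scope.

#[short(type="topGroupType")]
HB.structure Definition TopGroup := {G of Group G & Topological G}.

Definition smooth_on (R : realType) (V W : normedModType R)
    (U : set V) (f : V -> W) : Prop :=
  forall (s : seq V) (x : V), U x ->
    differentiable (foldr (fun v (g : V -> W) => 'D_v g) f s) x.

(* An atlas carries, besides its charts [coord i : dom i -> R^n], a preferred
   chart at every point. The tangent space T_p M is modelled on 'rV[R]_n: a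
   tangent vector at p is given by its components in the preferred chart at p,
   its components in the other charts being obtained through the derivatives
   of the transition maps ([to_chart], [from_chart]). *)
Record atlas (R : realType) (n : nat) (M : Type) := Atlas {
  chart_idx : Type;
  dom : chart_idx -> set M;
  coord : chart_idx -> M -> 'rV[R]_n;
  chart_at : M -> chart_idx }.

(* The inverse of the chart i; the value p outside of its image is irrelevant. *)
Definition param (R : realType) (n : nat) (M : Type) (A : atlas R n M)
    (i : chart_idx A) (p : M) : 'rV[R]_n -> M :=
  'pinv_(fun=> p) (dom i) (coord i).
Arguments param {R n M} A i p.

Record is_manifold (R : realType) (n : nat) (M : topologicalType)
    (A : atlas R n M) : Prop := IsManifold {
  manifold_hausdorff : hausdorff_space M;
  manifold_second_countable : @second_countable M;
  dom_chart_at : forall p, dom (chart_at A p) p;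
  dom_open : forall i : chart_idx A, open (dom i);
  coord_inj : forall i : chart_idx A, {in dom i &, injective (coord i)};
  coord_continuous :
    forall i : chart_idx A, {within dom i, continuous (coord i)};
  coord_open : forall (i : chart_idx A) (U : set M),
    open U -> U `<=` dom i -> open (coord i @` U);
  transition_smooth : forall (i j : chart_idx A) (p : M),
    smooth_on (coord i @` (dom i `&` dom j)) (coord j \o param A i p) }.

Section Smoothness.
Context {R : realType} {n k : nat} {M N : Type}.
Variables (A : atlas R n M) (B : atlas R k N).

Definition chart_nbhd (i : chart_idx A) (p : M) (W : set 'rV[R]_n) : Prop :=
  [/\ dom i p, open W, W (coord i p) & W `<=` coord i @` dom i].

Definition smooth_fun (f : M -> R) : Prop :=
  forall p, exists (i : chart_idx A) (W : set 'rV[R]_n),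
    chart_nbhd i p W /\ smooth_on W (f \o param A i p : 'rV[R]_n -> R^o).

Definition smooth_map (F : M -> N) : Prop :=
  forall p, exists (i : chart_idx A) (j : chart_idx B) (W : set 'rV[R]_n),
    [/\ chart_nbhd i p W,
        forall x, W x -> dom j (F (param A i p x)) &
        smooth_on W (coord j \o F \o param A i p)].

(* T_p F : T_p M -> T_(F p) N *)
Definition tmap (F : M -> N) (p : M) : 'Hom('rV[R]_n, 'rV[R]_k) :=
  let i := chart_at A p in
  linfun ('d (coord (chart_at B (F p)) \o F \o param A i p) (coord i p)).

Definition dfun (f : M -> R) (p : M) : 'Hom('rV[R]_n, R^o) :=
  let i := chart_at A p in
  linfun ('d (f \o param A i p : 'rV[R]_n -> R^o) (coord i p)).

Definition to_chart (i : chart_idx A) (p : M) : 'Hom('rV[R]_n, 'rV[R]_n) :=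
  let c := chart_at A p in linfun ('d (coord i \o param A c p) (coord c p)).

Definition from_chart (i : chart_idx A) (p : M) : 'Hom('rV[R]_n, 'rV[R]_n) :=
  linfun ('d (coord (chart_at A p) \o param A i p) (coord i p)).

(* The coordinate vector field d/dx^l of the chart i, at p *)
Definition coord_vector (i : chart_idx A) (p : M) (l : 'I_n) : 'rV[R]_n :=
  from_chart i p (delta_mx 0 l).

Definition smooth_vector_field (X : M -> 'rV[R]_n) : Prop :=
  forall p, exists (i : chart_idx A) (W : set 'rV[R]_n),
    chart_nbhd i p W /\
    smooth_on W (fun x => let q := param A i p x in to_chart i q (X q)).

(* Exterior derivative of a 1-form:
   (d theta)_p(u, v) = u(theta(v~)) - v(theta(u~)), where u~, v~ extend u, v
   with constant components in the preferred chart at p, so that [u~, v~] = 0. *)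
Definition ext_deriv (theta : M -> 'Hom('rV[R]_n, R^o)) (p : M)
    (u v : 'rV[R]_n) : R :=
  let i := chart_at A p in
  let theta_loc (w x : 'rV[R]_n) : R^o :=
    let q := param A i p x in theta q (from_chart i q w) in
  'D_u (theta_loc v) (coord i p) - 'D_v (theta_loc u) (coord i p).

Definition prod_atlas : atlas R (n + k) (M * N) :=
  @Atlas R (n + k) (M * N) (chart_idx A * chart_idx B)%type
    (fun ij => [set x | dom ij.1 x.1 /\ dom ij.2 x.2])
    (fun ij x => row_mx (coord ij.1 x.1) (coord ij.2 x.2))
    (fun x => (chart_at A x.1, chart_at B x.2)).

End Smoothness.

(* The Lie algebra is T_1 G, modelled on 'rV[R]_d. *)
Record is_lie_group (R : realType) (d : nat) (G : topGroupType)
    (AG : atlas R d G) : Prop := IsLieGroup {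
  lie_group_manifold : is_manifold AG;
  lie_group_mul :
    smooth_map (prod_atlas AG AG) AG (fun x : G * G => x.1 * x.2)%g;
  lie_group_inv : smooth_map AG AG (fun g : G => g^-1)%g }.

Section Actions.
Context {R : realType} {d n : nat} {G : topGroupType} {Q : topologicalType}.
Variables (AG : atlas R d G) (AQ : atlas R n Q) (phi : G -> Q -> Q).

Record is_smooth_action : Prop := IsSmoothAction {
  action1 : forall q, phi 1%g q = q;
  actionM : forall (g g' : G) q, phi (g * g')%g q = phi g (phi g' q);
  action_smooth : smooth_map (prod_atlas AG AQ) AQ (fun x => phi x.1 x.2) }.

Definition free_action : Prop := forall g q, phi g q = q -> g = 1%g.

Definition proper_action : Prop :=
  forall K : set (Q * Q), compact K ->
    compact ((fun x : G * Q => (phi x.1 x.2, x.2)) @^-1` K).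

(* xi |-> xi_Q(q), the derivative at 1 of the orbit map g |-> phi g q *)
Definition generator (q : Q) : 'Hom('rV[R]_d, 'rV[R]_n) :=
  tmap AG AQ (phi^~ q) 1%g.

End Actions.

(* (q, a) with a in the dual of T_q Q *)
Definition cotangent (R : realType) (n : nat) (Q : Type) : Type :=
  (Q * 'Hom('rV[R]_n, R^o))%type.

Section Cotangent.
Context {R : realType} {n : nat} {Q : topologicalType}.
Variable AQ : atlas R n Q.
Local Notation cotangent := (cotangent R n Q).

(* Canonical coordinates (x^k, p_k), p_k = a(d/dx^k) *)
Definition cotangent_atlas : atlas R (n + n) cotangent :=
  @Atlas R (n + n) cotangent (chart_idx AQ)
    (fun i => [set a | dom i a.1])
    (fun i a =>
       row_mx (coord i a.1) (\row_k (a.2 (coord_vector i a.1 k) : R)))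
    (fun a => chart_at AQ a.1).

Definition liouville (a : cotangent) : 'Hom('rV[R]_(n + n), R^o) :=
  (a.2 \o tmap cotangent_atlas AQ fst a)%VF.

Definition omegaQ (a : cotangent) (u v : 'rV[R]_(n + n)) : R :=
  - ext_deriv cotangent_atlas liouville a u v.

Definition cotangent_lift (G : topGroupType) (phi : G -> Q -> Q) (g : G)
    (a : cotangent) : cotangent :=
  (phi g a.1, (a.2 \o tmap AQ AQ (phi g^-1%g) (phi g a.1))%VF).

End Cotangent.

Section Fibration.
Context {R : realType} {n : nat} {Q : topologicalType}.
Variables (AQ : atlas R n.+1 Q) (Pi : Q -> R).

Local Notation cotangent := (cotangent R n.+1 Q).

(* eta = Pi^*(dt) = dPi *)
Definition eta (q : Q) : 'Hom('rV[R]_n.+1, R^o) := dfun AQ Pi q.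

Record is_fibration : Prop := IsFibration {
  fibration_smooth : smooth_fun AQ Pi;
  fibration_surj : forall t : R, exists q, Pi q = t;
  fibration_submersion : forall q, limg (eta q) = fullv }.

Definition vertical (q : Q) : {vspace 'rV[R]_n.+1} := lker (eta q).

Definition vdual : Type := {q : Q & 'Hom(subvs_of (vertical q), R^o)}.

Definition tau (b : vdual) : Q := projT1 b.

Definition mu (a : cotangent) : vdual :=
  existT (fun q => 'Hom(subvs_of (vertical q), R^o)) a.1
    (a.2 \o linfun (@vsval _ _ (vertical a.1)))%VF.

(* Where eta(d/dx^k) <> 0, the n vectors
     e_l = d/dx^l - (eta(d/dx^l) / eta(d/dx^k)) d/dx^k     (l <> k)
   form a frame of the vertical bundle. *)
Definition vertical_frame (i : chart_idx AQ) (k : 'I_n.+1) (q : Q) (j : 'I_n) :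
    'rV[R]_n.+1 :=
  let e l := coord_vector i q l in
  let r : R := eta q (e (lift k j)) / eta q (e k) in
  e (lift k j) - r *: e k.

(* The vector bundle charts of V^*Pi dual to the frames above *)
Definition vdual_atlas : atlas R (n.+1 + n) vdual :=
  @Atlas R (n.+1 + n) vdual (chart_idx AQ * 'I_n.+1)%type
    (fun ik => [set b | dom ik.1 (tau b) /\
       (eta (tau b) (coord_vector ik.1 (tau b) ik.2) : R) <> 0])
    (fun ik b => row_mx (coord ik.1 (tau b))
       (\row_j (projT2 b (vsproj (vertical (tau b))
                            (vertical_frame ik.1 ik.2 (tau b) j)) : R)))
    (fun b => let i := chart_at AQ (tau b) in
       (i, odflt ord0 [pick k | (eta (tau b) (coord_vector i (tau b) k) : R)
                                  != 0])).

Definition mu_basic (f : cotangent -> R) : Prop :=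
  exists2 f' : vdual -> R, smooth_fun vdual_atlas f' & f = f' \o mu.

Section HamiltonianSection.
Variable h : vdual -> cotangent.

Definition hamiltonian_section : Prop :=
  smooth_map vdual_atlas (cotangent_atlas AQ) h /\ forall b, mu (h b) = b.

(* F_h(a) is the s such that a - h(mu(a)) = s eta. *)
Definition ext_hamiltonian (a : cotangent) : R :=
  xget 0 [set s : R | a.2 - (h (mu a)).2 = s *: eta a.1].

Definition Omega (b : vdual) (u v : 'rV[R]_(n.+1 + n)) : R :=
  let Th := tmap vdual_atlas (cotangent_atlas AQ) h b in
  omegaQ AQ (h b) (Th u) (Th v).

Definition eta1 (b : vdual) (u : 'rV[R]_(n.+1 + n)) : R :=
  eta (tau b) (tmap vdual_atlas AQ tau b u).

(* These conditions characterize the vector field R_h. *)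
Record is_hamiltonian_dynamics (X : vdual -> 'rV[R]_(n.+1 + n)) : Prop :=
  IsHamiltonianDynamics {
    dynamics_smooth : smooth_vector_field vdual_atlas X;
    dynamics_Omega : forall b v, Omega b (X b) v = 0;
    dynamics_eta1 : forall b, eta1 b (X b) = 1 }.

End HamiltonianSection.

Section Symmetry.
Context {d : nat} {G : topGroupType}.
Variables (AG : atlas R d G) (phi : G -> Q -> Q).

Definition eta_invariant : Prop :=
  forall g q, (eta (phi g q) \o tmap AQ AQ (phi g) q)%VF = eta q.

(* When eta is invariant, T(phi g^-1) maps vertical vectors to vertical
   vectors, on which the projection [vsproj] is the identity. *)
Definition vdual_lift (g : G) (b : vdual) : vdual :=
  let q := tau b in
  existT (fun q => 'Hom(subvs_of (vertical q), R^o)) (phi g q)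
    (projT2 b \o linfun (vsproj (vertical q))
              \o tmap AQ AQ (phi g^-1%g) (phi g q)
              \o linfun (@vsval _ _ (vertical (phi g q))))%VF.

(* m(g) is the s such that Pi o phi_g = Pi + s. *)
Definition time_shift (g : G) : R :=
  xget 0 [set s : R | forall q, Pi (phi g q) = Pi q + s].

Definition cphi : 'Hom('rV[R]_d, R^o) := dfun AG time_shift 1%g.

(* The fiberwise linear function a_q |-> a_q(xi_Q(q)) *)
Definition generator_hat (xi : 'rV[R]_d) (a : cotangent) : R :=
  a.2 (generator AG AQ phi a.1 xi).

Variable h : vdual -> cotangent.

Definition equivariant_section : Prop :=
  forall g b, cotangent_lift AQ phi g (h b) = h (vdual_lift g b).

Definition momentum (a : cotangent) : 'Hom('rV[R]_d, R^o) :=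
  (a.2 \o generator AG AQ phi a.1)%VF - ext_hamiltonian h a *: cphi.

(* The map induced by [momentum] on V^*Pi, viewed as the quotient of T^*Q by
   mu: its value at b is the value of [momentum] at any point of mu^-1(b). *)
Definition momentumV (b : vdual) : 'Hom('rV[R]_d, R^o) :=
  momentum (xget (tau b, 0) [set a | mu a = b]).

End Symmetry.
End Fibration.

Arguments mu {R n Q} AQ Pi a.

(* Main.v *)
Require Import Defs.
From HB Require Import structures.
From mathcomp Require Import all_boot all_order all_algebra ring lra.
From mathcomp Require Import all_classical all_reals all_analysis.
Set Implicit Arguments.
Unset Strict Implicit.
Unset Printing Implicit Defensive.
Import Order.TTheory GRing.Theory Num.Theory numFieldNormedType.Exports.
(* [coord] must denote the charts of Defs, not the coordinates of vector.v. *)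
Import Defs.
Local Open Scope classical_set_scope.
Local Open Scope ring_scope.

(* A momentum component is constant along the dynamics because the function
   a |-> a(xi_Q) generates, up to sign, the cotangent-lifted flow of xi:
   moving a point a of T^*Q by the inverse lifted action, the curve
   A(g) = T^*phi_{g^-1}(a) satisfies omega_Q(u, T_1 A(xi)) = d(xi_Q^)(u) for
   all u. In coordinates this rests on the equality of mixed second derivatives
   of the action, differentiated once along xi and once along Q.

   Since d/dt Pi(phi_{exp t xi} q) = c_phi(xi), one has eta(xi_Q) = c_phi(xi),
   and pairing a - h(mu a) = F_h(a) eta with xi_Q gives
     xi_Q^ - c_phi(xi) F_h = xi_Q^ o h o mu,
   so J^V_xi = xi_Q^ o h. For a = h(b), equivariance gives A = h o mu o A, hence
   T_1 A(xi) = Th(v) with v = T_1(mu o A)(xi), and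
     dJ^V_xi(R_h) = omega_Q(Th(R_h), Th(v)) = Omega_h(R_h, v) = 0. *)

(** * Calculus of smooth germs *)

(** Two obstacles shape the proof. First, T^*Q and V^*Pi carry only explicit atlases, so the chain
    rule becomes available on them only after their transition maps are shown smooth. For V^*Pi this
    is inherited from T^*Q: in charts, mu has a linear section that puts one momentum equal to zero,
    and every transition of V^*Pi is such a section, followed by a transition of T^*Q, followed by
    mu. Second, inverse charts are total functions with an arbitrary value outside the image, so
    representatives agree only near a point; hence the calculus of germs. The inverse lift is chosen
    because its covector part is a o T phi_g, which involves derivatives of phi itself; the
    derivative of the base point phi_{g^-1}(q) then comes from phi_g(phi_{g^-1}(q)) = q, without
    differentiating the inversion of G explicitly. The curve in V^*Pi is written mu o A rather than
    as an orbit of the lifted action on V^*Pi, so its smoothness follows from that of A and mu.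
    Likewise the smoothness of xi_Q^ - c_phi(xi) F_h is read off its factorization through h,
    without treating F_h by itself. *)

Section Ck.
Context {R : realType}.
Implicit Types V W : normedModType R.

Lemma diff_near_eq V W (f g : V -> W) (x : V) :
  (\near x, f x = g x) -> differentiable f x -> 'd g x = 'd f x :> (V -> W).
Proof.
move=> fg df.
have fgx : f x = g x := nbhs_singleton fg.
have [cd fE] := (diff_locallyP _ _).1 df.
apply: diff_unique => //; apply/eqaddoP => e e0.
have fg0 : \forall h \near 0, f (h + x) = g (h + x).
  move: fg; rewrite (near_shift 0 x); apply: filterS => h /=.
  by rewrite subr0.
move/eqaddoP : fE => /(_ e e0); apply: filterS2 fg0 => h fgh.
by rewrite !fctE /= -fgx fgh.
Qed.

Lemma near_eq_differentiable V W (f g : V -> W) (x : V) :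
  (\near x, f x = g x) -> differentiable f x -> differentiable g x.
Proof.
move=> fg df.
have fgx : f x = g x := nbhs_singleton fg.
have [cd fE] := (diff_locallyP _ _).1 df.
apply/diff_locallyP; rewrite (diff_near_eq fg df); split => //.
apply/eqaddoP => e e0.
have fg0 : \forall h \near 0, f (h + x) = g (h + x).
  move: fg; rewrite (near_shift 0 x); apply: filterS => h /=.
  by rewrite subr0.
move/eqaddoP : fE => /(_ e e0); apply: filterS2 fg0 => h fgh.
by rewrite !fctE /= -fgx fgh.
Qed.

(** Stratification of [smooth_on] by order, so that the product, quotient and chain rules go by
    induction. The index is one behind the order: [Ck 0] is differentiability. *)
Fixpoint Ck V W (k : nat) (U : set V) (f : V -> W) : Prop :=
  (forall x, U x -> differentiable f x) /\
  if k is k'.+1 then forall v, Ck k' U ('D_v f) else True.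

Lemma Ck_differentiable V W k (U : set V) (f : V -> W) x :
  Ck k U f -> U x -> differentiable f x.
Proof. by case: k => [|k] [df _]; exact: df. Qed.

(** In the [foldr] of [smooth_on] the last direction of the sequence differentiates first, so
    sequences are peeled from the right to match the recursion of [Ck]. *)
Lemma smooth_onP V W (U : set V) (f : V -> W) :
  smooth_on U f <-> forall k, Ck k U f.
Proof.
split=> [fU k|fU s x Ux].
  elim: k f fU => [|k IHk] f fU; (split; first by move=> x; exact: (fU [::] x))
    => // v.
  by apply: IHk => s x Ux; have := fU (rcons s v) x Ux; rewrite foldr_rcons.
elim/last_ind: s f fU => [|s v IHs] f fU; first exact: Ck_differentiable (fU
  0%N) Ux.
by rewrite foldr_rcons; apply: IHs => k; have [_] := fU k.+1; apply.
Qed.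

Lemma CkS V W k (U : set V) (f : V -> W) : Ck k.+1 U f -> Ck k U f.
Proof.
elim: k f => [|k IHk] f [df dkf]; split=> // v.
by apply: IHk; exact: dkf.
Qed.

Lemma smooth_onW V W (U U' : set V) (f : V -> W) :
  U' `<=` U -> smooth_on U f -> smooth_on U' f.
Proof. by move=> UU' fU s x /UU'; exact: fU. Qed.

Lemma open_near V (U : set V) (P : V -> Prop) x :
  open U -> (forall y, U y -> P y) -> U x -> \near x, P x.
Proof. by move=> oU UP Ux; apply: filterS UP _; exact: open_nbhs_nbhs. Qed.

Lemma eq_Ck V W k (U : set V) (f g : V -> W) :
  open U -> (forall x, U x -> f x = g x) -> Ck k U f -> Ck k U g.
Proof.
move=> oU; elim: k f g => [|k IHk] f g fg [df dkf];
  (split; first by move=> x Ux; apply: near_eq_differentiable (df _ Ux); exact: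
    open_near fg Ux) => // v.
apply: IHk (dkf v) => x Ux; apply: near_eq_derive; exact: open_near fg Ux.
Qed.

Lemma Ck_cst V W k (U : set V) (c : W) : Ck k U (cst c : V -> W).
Proof.
elim: k c => [|k IHk] c; split => // v.
suff -> : 'D_v (cst c : V -> W) = cst 0 by exact: IHk.
by apply/funext => x; rewrite derive_cst.
Qed.

Lemma CkD V W k (U : set V) (f g : V -> W) :
  open U -> Ck k U f -> Ck k U g -> Ck k U (f \+ g).
Proof.
move=> oU; elim: k f g => [|k IHk] f g fk gk;
  (split; first by move=> x Ux; apply: differentiableD; [exact:
    Ck_differentiable fk Ux|exact: Ck_differentiable gk Ux]) => // v.
have [[df dkf] [dg dkg]] := (fk, gk).
apply: eq_Ck oU _ (IHk _ _ (dkf v) (dkg v)) => x Ux.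
by rewrite [RHS]deriveD//; apply: diff_derivable; [exact: df|exact: dg].
Qed.

Lemma Ck_sum V W k (U : set V) I (r : seq I) (F : I -> V -> W) :
  open U -> (forall i, Ck k U (F i)) -> Ck k U (fun x => \sum_(i <- r) F i x).
Proof.
move=> oU Fk; elim: r => [|i r IHr].
  by under eq_fun do rewrite big_nil; exact: Ck_cst.
by under eq_fun do rewrite big_cons; exact: CkD.
Qed.

Lemma CkM V k (U : set V) (f g : V -> R^o) :
  open U -> Ck k U f -> Ck k U g -> Ck k U (fun x => f x * g x : R^o).
Proof.
move=> oU; elim: k f g => [|k IHk] f g fk gk;
  (split; first by move=> x Ux; apply: differentiableM; [exact:
    Ck_differentiable fk Ux|exact: Ck_differentiable gk Ux]) => // v.
have [[df dkf] [dg dkg]] := (fk, gk).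
have fg := CkD oU (IHk _ _ (CkS fk) (dkg v)) (IHk _ _ (CkS gk) (dkf v)).
apply: eq_Ck oU _ fg => x Ux.
by rewrite [RHS]deriveM//; apply: diff_derivable; [exact: df|exact: dg].
Qed.

(** The derivative of 1/f is -(1/f)^2 'D_v f, where 1/f is already of the lower order by
    induction. *)
Lemma CkV V k (U : set V) (f : V -> R^o) :
  open U -> (forall x, U x -> f x != 0) ->
  Ck k U f -> Ck k U (fun x => (f x)^-1 : R^o).
Proof.
move=> oU f0; elim: k => [|k IHk] fk;
  (split; first by move=> x Ux; apply: differentiableV; [exact:
    Ck_differentiable fk Ux|exact: f0]) => // v.
have [df dkf] := fk.
have fV := IHk (CkS fk).
have fg := CkM oU (CkM oU fV fV) (CkM oU (Ck_cst k U (-1 : R^o)) (dkf v)).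
apply: eq_Ck oU _ fg => x Ux.
rewrite [RHS]deriveV ?f0//; last by apply: diff_derivable; exact: df.
by rewrite /= mulN1r mulrN -invfM -expr2 scaleNr.
Qed.


Lemma differentiable_rowP V n (f : V -> 'rV[R]_n) x :
  differentiable f x <-> forall j, differentiable (fun y => f y 0 j : R^o) x.
Proof.
split=> [df j|df].
  apply: (@differentiable_comp _ _ _ R^o f (fun y : 'rV[R]_n => y 0 j) x df).
  exact: differentiable_coord.
have -> : f = \sum_(j < n) (fun y => f y 0 j *: (delta_mx 0 j : 'rV[R]_n)).
  by apply/funext => y; rewrite fct_sumE -row_sum_delta.
by apply: differentiable_sum => j; exact: differentiableZl.
Qed.

Lemma derive_row V n (f : V -> 'rV[R]_n) x v j :
  differentiable f x -> 'D_v (fun y => f y 0 j : R^o) x = 'D_v f x 0 j.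
Proof. by move=> df; rewrite derive_mx ?mxE//; exact: diff_derivable. Qed.

Lemma Ck_rowP V n k (U : set V) (f : V -> 'rV[R]_n) : open U ->
  Ck k U f <-> forall j, Ck k U (fun y => f y 0 j : R^o).
Proof.
move=> oU; split.
  elim: k f => [|k IHk] f [df dkf] j;
    (split; first by move=> x Ux; apply/(differentiable_rowP f x).1/df) => // v.
  apply: eq_Ck oU _ (IHk _ (dkf v) j) => x Ux.
  by rewrite derive_row//; exact: df.
elim: k f => [|k IHk] f fk;
  (split; first by move=> x Ux; apply/differentiable_rowP => j; exact:
    Ck_differentiable (fk j) Ux) => // v.
apply: IHk => j.
have [df dkf] := fk j.
apply: eq_Ck oU _ (dkf v) => x Ux.
rewrite derive_row//; apply/differentiable_rowP => i.
exact: Ck_differentiable (fk i) Ux.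
Qed.

Lemma derive_comp (U V W : normedModType R) (f : U -> V) (g : V -> W) x v :
  differentiable f x -> differentiable g (f x) ->
  'D_v (g \o f) x = 'd g (f x) ('D_v f x).
Proof.
move=> df dg; rewrite (deriveE _ df) (deriveE _ (differentiable_comp df dg)).
by rewrite diff_comp.
Qed.

Lemma diff_rowE n W (g : 'rV[R]_n -> W) x w : differentiable g x ->
  'd g x w = \sum_j w 0 j *: 'D_(delta_mx 0 j) g x.
Proof.
move=> dg; rewrite [in LHS](row_sum_delta w) linear_sum.
by apply: eq_bigr => j _; rewrite linearZ/= deriveE.
Qed.

(** The derivative of g o f along v is the sum over j of ('D_v f)_j times ('D_j g) o f, a sum of
    products to whose second factors the induction hypothesis applies. *)
Lemma Ck_comp V n k (U : set V) (U' : set 'rV[R]_n)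
    (f : V -> 'rV[R]_n) (g : 'rV[R]_n -> R^o) :
  open U -> (forall x, U x -> U' (f x)) -> Ck k U f -> Ck k U' g ->
  Ck k U (g \o f).
Proof.
move=> oU fU; elim: k f fU g => [|k IHk] f fU g fk gk;
  (split; first by move=> x Ux; apply: differentiable_comp;
    [exact: Ck_differentiable fk Ux|exact: Ck_differentiable gk (fU _ Ux)]) =>
    // v.
have [[df dkf] [dg dkg]] := (fk, gk).
have H j : Ck k U (fun x => ('D_v f x 0 j : R^o) * ('D_(delta_mx 0 j) g \o f) x
  : R^o).
  apply: CkM => //; first exact: (Ck_rowP k ('D_v f) oU).1 (dkf v) j.
  exact: IHk fU _ (CkS fk) (dkg _).
apply: eq_Ck oU _ (Ck_sum (index_enum _) oU H) => x Ux.
rewrite [RHS]derive_comp ?diff_rowE//; by [exact: df|exact/dg/fU].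
Qed.

Lemma Ck_linear V W k (U : set V) (f : {linear V -> W}) :
  continuous f -> Ck k U f.
Proof.
move=> cf; case: k => [|k]; (split; first by move=> x _; exact:
  linear_differentiable) => // v.
suff -> : 'D_v f = cst (f v) by exact: Ck_cst.
by apply/funext => x; rewrite deriveE ?diff_lin//; exact: linear_differentiable.
Qed.

End Ck.

Section smooth_at.
Context {R : realType}.
Implicit Types V W : normedModType R.

(** One neighbourhood serves all orders. A germ notion is required because chart representatives
    built with [param] are meaningful only near the base point. *)
Definition smooth_at V W (f : V -> W) (x : V) : Prop :=
  exists2 U, open_nbhs x U & smooth_on U f.

Lemma smooth_onE V W (U : set V) (f : V -> W) x :
  open U -> smooth_on U f -> U x -> smooth_at f x.
Proof. by move=> oU fU Ux; exists U. Qed.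

Lemma smooth_at_near V W (f : V -> W) x :
  smooth_at f x -> \near x, smooth_at f x.
Proof.
move=> [U oU fU]; apply: filterS (open_nbhs_nbhs oU) => y Uy.
by exists U => //; split=> //; exact: oU.1.
Qed.

Lemma smooth_at_diff V W (f : V -> W) x : smooth_at f x -> differentiable f x.
Proof. by move=> [U [_ Ux] fU]; exact: (fU [::]). Qed.

Lemma smooth_at_continuous V W (f : V -> W) x :
  smooth_at f x -> {for x, continuous f}.
Proof. by move=> /smooth_at_diff; exact: differentiable_continuous. Qed.

Lemma smooth_at_near_preimage V W (f : V -> W) x (P : W -> Prop) :
  smooth_at f x -> (\forall y \near f x, P y) -> \forall y \near x, P (f y).
Proof. by move=> /smooth_at_continuous fc nP; exact: (fc P nP). Qed.

Lemma smooth_at_derive V W (f : V -> W) x v :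
  smooth_at f x -> smooth_at ('D_v f) x.
Proof.
move=> [U oU fU]; exists U => //; apply/smooth_onP => k.
by have [_] := (smooth_onP _ _).1 fU k.+1; apply.
Qed.

Lemma smooth_at_lift2 V W W1 W2 (f1 : V -> W1) (f2 : V -> W2) (f : V -> W) x :
  (forall k U, open U -> (\forall y \near x, U y) -> Ck k U f1 -> Ck k U f2 ->
    Ck k U f) ->
  smooth_at f1 x -> smooth_at f2 x -> smooth_at f x.
Proof.
move=> H [U1 oU1 f1U] [U2 oU2 f2U].
have oU := open_nbhsI oU1 oU2.
exists (U1 `&` U2) => //; apply/smooth_onP => k; apply: H.
- exact: oU.1.
- exact: open_nbhs_nbhs.
- by apply: (smooth_onP _ _).1; apply: smooth_onW f1U => y [].
- by apply: (smooth_onP _ _).1; apply: smooth_onW f2U => y [].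
Qed.

Lemma near_eq_smooth_at V W (f g : V -> W) x :
  (\near x, f x = g x) -> smooth_at f x -> smooth_at g x.
Proof.
move=> fg [U oU fU].
exists (U `&` [set x | f x = g x]^°).
  apply: open_nbhsI => //; split; first exact: open_interior.
  exact: fg.
apply/smooth_onP => k; apply: (@eq_Ck _ _ _ _ _ f) (openI oU.1 (@open_interior
  _ _)) _ _.
  by move=> y [_ /interior_subset].
by apply: (smooth_onP _ _).1; apply: smooth_onW fU => y [].
Qed.

Lemma smooth_at_cst V W (c : W) (x : V) : smooth_at (cst c) x.
Proof. by exists setT; [exact: open_nbhsT|apply/smooth_onP => k; exact:
  Ck_cst]. Qed.

Lemma smooth_atD V W (f g : V -> W) x :
  smooth_at f x -> smooth_at g x -> smooth_at (fun y => f y + g y) x.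
Proof. by apply: smooth_at_lift2 => k U oU _; exact: CkD. Qed.

Lemma smooth_atM V (f g : V -> R^o) x :
  smooth_at f x -> smooth_at g x -> smooth_at (fun y => f y * g y : R^o) x.
Proof. by apply: smooth_at_lift2 => k U oU _; exact: CkM. Qed.

Lemma smooth_at_sum V W I (r : seq I) (F : I -> V -> W) x :
  (forall i, smooth_at (F i) x) -> smooth_at (fun y => \sum_(i <- r) F i y) x.
Proof.
move=> FS; elim: r => [|i r IHr].
  by under eq_fun do rewrite big_nil; exact: smooth_at_cst.
by under eq_fun do rewrite big_cons; exact: smooth_atD.
Qed.

Lemma smooth_atV V (f : V -> R^o) x :
  f x != 0 -> smooth_at f x -> smooth_at (fun y => (f y)^-1 : R^o) x.
Proof.
move=> f0 fS; have := smooth_at_continuous fS => fc.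
have : \near x, f x != 0.
  exact: (fc [set y | y != 0] (open_nbhs_nbhs (conj (@open_neq R 0) f0))).
move: fS => [U [oU Ux] fU] nf.
exists (U `&` [set x | f x != 0]^°).
  by apply: open_nbhsI => //; split; [exact: open_interior|exact: nf].
apply/smooth_onP => k; apply: CkV.
- exact: openI oU (@open_interior _ _).
- by move=> y [_ /interior_subset].
- by apply: (smooth_onP _ _).1; apply: smooth_onW fU => y [].
Qed.

Lemma smooth_at_rowP V n (f : V -> 'rV[R]_n) x :
  smooth_at f x <-> forall j, smooth_at (fun y => f y 0 j : R^o) x.
Proof.
split=> [[U oU fU] j|fS].
  exists U => //; apply/smooth_onP => k.
  exact: (Ck_rowP k f oU.1).1 ((smooth_onP _ _).1 fU k) j.
have /choice [U HU] j : exists U, open_nbhs x U /\ smooth_on U (fun y => f y 0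
  j : R^o).
  by have [U ? ?] := fS j; exists U.
exists (\bigcap_j U j)^°.
  split; first exact: open_interior.
  suff : \near x, forall j, U j x by apply: filterS => y Hy j _; exact: Hy.
  by apply: filter_forall => j; exact/open_nbhs_nbhs/(HU j).1.
apply/smooth_onP => k; apply/Ck_rowP => [|j]; first exact: open_interior.
by apply: (smooth_onP _ _).1; apply: smooth_onW (HU j).2 => y /interior_subset;
  apply.
Qed.

Lemma smooth_at_comp_real V n (f : V -> 'rV[R]_n) (g : 'rV[R]_n -> R^o) x :
  smooth_at f x -> smooth_at g (f x) -> smooth_at (g \o f) x.
Proof.
move=> fS; have fc := smooth_at_continuous fS.
move: fS => [U [oU Ux] fU] [U' oU' gU'].
exists (U `&` (f @^-1` U')^°).
  split; first exact: openI oU (@open_interior _ _).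
  split=> //; exact/fc/open_nbhs_nbhs.
apply/smooth_onP => k; apply: (@Ck_comp _ _ _ _ _ U').
- exact: openI oU (@open_interior _ _).
- by move=> y [_ /interior_subset].
- by apply: (smooth_onP _ _).1; apply: smooth_onW fU => y [].
- exact: (smooth_onP _ _).1.
Qed.

Lemma smooth_at_comp V n m (f : V -> 'rV[R]_n) (g : 'rV[R]_n -> 'rV[R]_m) x :
  smooth_at f x -> smooth_at g (f x) -> smooth_at (g \o f) x.
Proof.
move=> fS /smooth_at_rowP gS; apply/smooth_at_rowP => j.
exact: smooth_at_comp_real (gS j).
Qed.

Lemma smooth_at_linear V W (f : {linear V -> W}) x :
  continuous f -> smooth_at f x.
Proof.
by move=> cf; exists setT; [exact: open_nbhsT|apply/smooth_onP => k; exact: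
  Ck_linear].
Qed.

Lemma smooth_at_id V (x : V) : smooth_at (id : V -> V) x.
Proof. by apply: (@smooth_at_linear _ _ idfun) => y; exact: cvg_id. Qed.

Lemma smooth_atZ V (c : R) (f : V -> R^o) x :
  smooth_at f x -> smooth_at (fun y => c * f y : R^o) x.
Proof. by apply: smooth_atM; exact: smooth_at_cst. Qed.

Lemma smooth_atB V (f g : V -> R^o) x :
  smooth_at f x -> smooth_at g x -> smooth_at (fun y => f y - g y : R^o) x.
Proof.
move=> fS gS; apply: smooth_atD => //.
under eq_fun do rewrite -mulN1r; exact: smooth_atZ.
Qed.

Lemma smooth_at_coord V n (f : V -> 'rV[R]_n) j x :
  smooth_at f x -> smooth_at (fun y => f y 0 j : R^o) x.
Proof. by move/smooth_at_rowP. Qed.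

Lemma smooth_at_lsubmx V n m (f : V -> 'rV[R]_(n + m)) x :
  smooth_at f x -> smooth_at (fun y => lsubmx (f y)) x.
Proof.
move=> fS; apply: (@smooth_at_comp _ _ _ f lsubmx) => //.
by apply: smooth_at_linear; exact: continuous_lsubmx.
Qed.

Lemma smooth_at_rsubmx V n m (f : V -> 'rV[R]_(n + m)) x :
  smooth_at f x -> smooth_at (fun y => rsubmx (f y)) x.
Proof.
move=> fS; apply: (@smooth_at_comp _ _ _ f rsubmx) => //.
by apply: smooth_at_linear; exact: continuous_rsubmx.
Qed.

Lemma smooth_at_row_mx V n m (f : V -> 'rV[R]_n) (g : V -> 'rV[R]_m) x :
  smooth_at f x -> smooth_at g x -> smooth_at (fun y => row_mx (f y) (g y)) x.
Proof.
move=> /smooth_at_rowP fS /smooth_at_rowP gS; apply/smooth_at_rowP => j.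
rewrite -(splitK j); case: (fintype.split j) => i /=.
  by under eq_fun do rewrite row_mxEl; exact: fS.
by under eq_fun do rewrite row_mxEr; exact: gS.
Qed.

End smooth_at.

(** * Symmetry of second derivatives *)

Section Clairaut.
Context {R : realType} {V : normedModType R}.
Implicit Types (f : V -> R^o) (x u v : V).

Lemma is_derive_line f (y u : V) (s : R) : differentiable f (s *: u + y) ->
  is_derive s (1 : R) (fun s : R => f (s *: u + y)) ('D_u f (s *: u + y)).
Proof.
move=> /(@diff_derivable _ _ _ _ _ u) df.
have E : (fun h : R => h^-1 *: (f ((h *: (1 : R) + s) *: u + y) - f (s *: u +
  y))) =
         (fun h => h^-1 *: (f (h *: u + (s *: u + y)) - f (s *: u + y))).
  by apply/funext => h; rewrite scalerDl addrA [h *: (1 : R)]mulr1.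
by apply: DeriveDef; rewrite /derivable /derive/= E.
Qed.

(** The mean value theorem on [0, t] for F(s) = f(su + tv + x) - f(su + x) turns the second
    difference into t F'(c). Here F'(c) is an increment of 'D_u f, which differentiability of 'D_u f
    at x estimates by t 'D_v ('D_u f) x. *)
Lemma second_difference f x u v (e : R) : smooth_at f x -> 0 < e ->
  \forall t \near 0^'+, `|f (t *: u + (t *: v + x)) - f (t *: u + x) - f (t *:
    v + x) + f x
    - t ^+ 2 * 'D_v ('D_u f) x| <= e * t ^+ 2.
Proof.
move=> fS e0.
have dg : differentiable ('D_u f) x by exact/smooth_at_diff/smooth_at_derive.
have df : \near x, differentiable f x.
  by apply: filterS (smooth_at_near fS) => y; exact: smooth_at_diff.
(* t K bounds both su and su + tv for s in [0, t]; the summand 1 makes K positive even if u = v =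
   0. *)
pose K := `|u| + `|v| + 1.
have K0 : 0 < K by rewrite ltr_wpDl// addr_ge0.
(* Each of the two expansions of 'D_u f errs by at most e / (2K) * tK = (e/2) t; together, and
   multiplied by t, they give e t^2. *)
have e1 : 0 < e / (2 * K) by rewrite divr_gt0// mulr_gt0.
have /eqaddoP/(_ _ e1)/nbhs_ballP[d1 /= d10 Hg] := diff_locally dg.
have /nbhs_ballP[d2 /= d20 Hf] := df.
pose d := Num.min d1 d2.
have d0 : 0 < d by rewrite lt_min d10.
near=> t.
have t0 : 0 < t by near: t; exact: nbhs_right_gt.
have tK : t * K < d.
  rewrite -ltr_pdivlMr//; near: t; apply: nbhs_right_lt; exact: divr_gt0.
have small s : 0 <= s <= t -> `|s *: u| <= t * K /\ `|s *: u + t *: v| <= t * K.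
  move=> /andP[s0 st].
  have su : `|s *: u| <= t * `|u| by rewrite normrZ ger0_norm// ler_wpM2r.
  split.
    apply: le_trans su _; rewrite ler_pM2l// /K -addrA lerDl addr_ge0//.
  apply: le_trans (ler_normD _ _) _.
  rewrite /K !mulrDr mulr1 -[leLHS]addr0 lerD ?(ltW t0)//.
  by rewrite lerD// normrZ gtr0_norm.
have inball1 (w : V) : `|w| <= t * K -> ball 0 d1 w.
  move=> wd; rewrite -ball_normE/= sub0r normrN (le_lt_trans wd)// (lt_le_trans
    tK)//.
  by rewrite ge_min lexx.
have inball2 (w : V) : `|w| <= t * K -> differentiable f (w + x).
  move=> wd; apply: Hf; rewrite -ball_normE/= opprD addrCA subrr addr0 normrN.
  by rewrite (le_lt_trans wd)// (lt_le_trans tK)// ge_min lexx orbT.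
pose F (s : R) : R := f (s *: u + (t *: v + x)) - f (s *: u + x).
pose dF (s : R) : R := 'D_u f (s *: u + (t *: v + x)) - 'D_u f (s *: u + x).
have FdF s : 0 <= s <= t -> is_derive s (1 : R) F (dF s).
  move=> /small[s1 s2]; apply: is_deriveB.
    by apply: is_derive_line; rewrite addrA; exact: inball2.
  by apply: is_derive_line; exact: inball2.
have [] := @MVT R F dF 0 t t0.
- by move=> s; rewrite in_itv/= => /andP[s0 st]; apply: FdF; rewrite !ltW.
- apply: derivable_within_continuous => s; rewrite in_itv/= => /FdF FdFs.
  exact: ex_derive.
move=> c; rewrite in_itv/= => /andP[c0 ct]; rewrite subr0 => FE.
have [c1 c2] : `|c *: u| <= t * K /\ `|c *: u + t *: v| <= t * K.
  by apply: small; rewrite !ltW.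
have := Hg _ (inball1 _ c1); have := Hg _ (inball1 _ c2).
have dE : 'd ('D_u f) x (c *: u + t *: v) = 'd ('D_u f) x (c *: u) + t * 'D_v
  ('D_u f) x.
  by rewrite (deriveE _ dg) linearD; congr (_ + _); rewrite linearZ.
have -> : f (t *: u + (t *: v + x)) - f (t *: u + x) - f (t *: v + x) + f x =
  dF c * t.
  by rewrite -FE /F !scale0r !add0r; ring.
rewrite !fctE/= dE -[c *: u + _ + x]addrA /dF.
set D := 'D_v _ x; set A := 'd _ _ _; set a := 'D_u f (_ + (_ + _)).
set b := 'D_u f (_ + _); set g := 'D_u f x.
have eK : e / (2 * K) * (t * K) = e / 2 * t by field; rewrite gt_eqF.
move=> H1 H2.
have {}H1 : `|a - (g + (A + t * D))| <= e / 2 * t.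
  apply: le_trans H1 (le_trans (ler_wpM2l (ltW e1) c2) _).
  by rewrite eK.
have {}H2 : `|b - (g + A)| <= e / 2 * t.
  apply: le_trans H2 (le_trans (ler_wpM2l (ltW e1) c1) _).
  by rewrite eK.
have -> : (a - b) * t - t ^+ 2 * D = ((a - (g + (A + t * D))) - (b - (g + A)))
  * t by ring.
rewrite normrM (gtr0_norm t0) expr2 mulrA ler_pM2r//.
apply: le_trans (ler_normB _ _) _; apply: le_trans (lerD H1 H2) _.
by rewrite -mulrDl -splitr.
Unshelve. all: by end_near. Qed.

(* The second difference is symmetric in u and v. *)
Lemma derive_comm f x u v : smooth_at f x -> 'D_u ('D_v f) x = 'D_v ('D_u f) x.
Proof.
move=> fS; apply/eqP; rewrite -subr_eq0 -normr_le0; apply/ler_addgt0Pl => e e0;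
  rewrite addr0.
have e2 : 0 < e / 2 by rewrite divr_gt0.
have P1 := second_difference u v fS e2.
have P2 := second_difference v u fS e2.
have P0 : \forall t \near (0 : R)^'+, 0 < t by exact: nbhs_right_gt.
have FF : ProperFilter (0 : R)^'+ by exact: at_right_proper_filter.
have [t [t0 [H1 H2]]] := @filter_ex _ _ FF _ (@filterI _ _ FF _ _ P0 (@filterI
  _ _ FF _ _ P1 P2)).
move: H1 H2; rewrite [t *: v + (t *: u + x)]addrCA.
move: (f (t *: u + (t *: v + x))) (f (t *: u + x)) (f (t *: v + x)) (f x) => a
  b c d.
move: ('D_v ('D_u f) x) ('D_u ('D_v f) x) => A B H1 H2.
have t20 : 0 < t ^+ 2 by exact: exprn_gt0.
rewrite -(ler_pM2r t20) -[X in _ * X](gtr0_norm t20) -normrM.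
have -> : (B - A) * t ^+ 2 = (a - b - c + d - t ^+ 2 * A) - (a - c - b + d - t
  ^+ 2 * B) by ring.
apply: le_trans (ler_normB _ _) _; apply: le_trans (lerD H1 H2) _.
by rewrite -mulrDl -splitr.
Qed.

End Clairaut.

Lemma derive_comm_row (R : realType) (V : normedModType R) n (f : V ->
  'rV[R]_n) x u v :
  smooth_at f x -> 'D_u ('D_v f) x = 'D_v ('D_u f) x.
Proof.
move=> fS; apply/rowP => j.
have E w w' : 'D_w' ('D_w f) x 0 j = 'D_w' ('D_w (fun y => f y 0 j : R^o)) x.
  rewrite -derive_row; last exact/smooth_at_diff/smooth_at_derive.
  apply: near_eq_derive; apply: filterS (smooth_at_near fS) => y
    /smooth_at_diff fy.
  by rewrite derive_row.
rewrite [LHS]E [RHS]E; apply: derive_comm; exact: smooth_at_coord.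
Qed.

(** * Smooth maps in charts *)

(* What remains of [is_manifold] without a topology on M: the total spaces
   T^*Q and V^*Pi are plain types. *)
Record smooth_atlas (R : realType) (n : nat) (M : Type) (A : atlas R n M) :
  Prop :=
  SmoothAtlas {
  atlas_dom_chart_at : forall p, dom (chart_at A p) p;
  atlas_coord_inj : forall i : chart_idx A, {in dom i &, injective (coord i)};
  atlas_overlap : forall (i j : chart_idx A) p, dom i p -> dom j p ->
    nbhs (coord i p) (coord i @` (dom i `&` dom j));
  atlas_transition : forall (i j : chart_idx A) p, dom i p -> dom j p ->
    smooth_at (coord j \o param A i p) (coord i p) }.

Lemma manifold_smooth_atlas (R : realType) (n : nat) (M : topologicalType)
  (A : atlas R n M) : is_manifold A -> smooth_atlas A.
Proof.
move=> mA; have op (i j : chart_idx A) : open (coord i @` (dom i `&` dom j)).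
  apply: (coord_open mA); first by apply: openI; exact: (dom_open mA).
  by move=> x [].
split=> [p|i|i j p ip jp|i j p ip jp].
- exact: (dom_chart_at mA).
- exact: (coord_inj mA).
- by apply: open_nbhs_nbhs; split => //; exists p.
- by apply: smooth_onE (op i j) _ _; [exact: (transition_smooth mA)|exists p].
Qed.

Lemma inj_param_coord (R : realType) (n : nat) (M : Type) (A : atlas R n M)
    (i : chart_idx A) (p q : M) :
  {in dom i &, injective (coord i)} -> dom i q -> param A i p (coord i q) = q.
Proof. by move=> inj iq; apply: (pinvKV (fun=> p) inj); rewrite inE. Qed.

Section Charts.
Context {R : realType} {n : nat} {M : Type} {A : atlas R n M}.
Hypothesis SA : smooth_atlas A.
Implicit Types (i j : chart_idx A) (p q : M).

Lemma param_coord i p q : dom i q -> param A i p (coord i q) = q.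
Proof. exact/inj_param_coord/atlas_coord_inj. Qed.

Lemma near_overlap i j p : dom i p -> dom j p -> \forall x \near coord i p,
  [/\ dom i (param A i p x), dom j (param A i p x) & coord i (param A i p x) =
    x].
Proof.
move=> ip jp; apply: filterS (atlas_overlap SA ip jp) => _ [q [iq jq] <-].
by rewrite param_coord.
Qed.

Lemma near_param i p : dom i p -> \forall x \near coord i p,
  dom i (param A i p x) /\ coord i (param A i p x) = x.
Proof. by move=> ip; apply: filterS (near_overlap ip ip) => x []. Qed.

(** The base point of [param] is only the default value outside the image of the chart, and the
    image contains a neighbourhood of [coord i p]. *)
Lemma near_param_base i p : dom i p -> \forall x \near coord i p,
  forall q, param A i q x = param A i p x.
Proof.
move=> ip; apply: filterS (atlas_overlap SA ip ip) => _ [q [iq _] <-] q'.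
by rewrite !param_coord.
Qed.

End Charts.

Section SmoothMaps.
Context {R : realType}.

(** Quantified over all charts, so that preferred and adapted charts can be exchanged freely. The
    first clause stands in for continuity of F, as M and N are plain types. *)
Definition smooth_map_at n k (M N : Type) (A : atlas R n M) (B : atlas R k N)
    (F : M -> N) (p : M) : Prop :=
  forall (i : chart_idx A) (j : chart_idx B), dom i p -> dom j (F p) ->
  (\forall x \near coord i p, dom j (F (param A i p x))) /\
  smooth_at (coord j \o F \o param A i p) (coord i p).

Definition smooth_fun_at n (M : Type) (A : atlas R n M) (f : M -> R) (p : M) :
  Prop :=
  forall i : chart_idx A, dom i p ->
  smooth_at (f \o param A i p : 'rV[R]_n -> R^o) (coord i p).

Section OneMap.
Context {n k : nat} {M N : Type} {A : atlas R n M} {B : atlas R k N}.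
Hypotheses (SA : smooth_atlas A) (SB : smooth_atlas B).

(** Near the point, the representative in the charts i', j' is the given one between the transitions
    from i' to i and from j to j'. *)
Lemma smooth_map_at_chart (F : M -> N) p (i : chart_idx A) (j : chart_idx B) :
  dom i p -> dom j (F p) ->
  (\forall x \near coord i p, dom j (F (param A i p x))) ->
  smooth_at (coord j \o F \o param A i p) (coord i p) -> smooth_map_at A B F p.
Proof.
move=> ip jp ndom FS i' j' i'p j'p.
pose T := coord i \o param A i' p.
have TS : smooth_at T (coord i' p) by exact: atlas_transition.
have Tp : T (coord i' p) = coord i p by rewrite /T/= param_coord.
pose G := coord j \o F \o param A i p.
have Gp : G (coord i p) = coord j (F p) by rewrite /G/= param_coord.
have nT : \forall x \near coord i' p, param A i p (T x) = param A i' p x.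
  by apply: filterS (near_overlap SA i'p ip) => x [_ ipx _]; rewrite /T/=
    param_coord.
(* The values of G stay in the image of the overlap of j and j', where the inverse of the chart j is
   a genuine inverse. *)
have nG : \forall y \near coord i p,
    dom j' (F (param A i p y)) /\ param B j (F p) (G y) = F (param A i p y).
  have jj' := atlas_overlap SB jp j'p; rewrite -Gp in jj'.
  have := smooth_at_continuous FS jj'; apply: filterS2 ndom => y jy [q [jq j'q]
    qE].
  have qEF : q = F (param A i p y).
    by apply: (atlas_coord_inj SB) qE; rewrite inE.
  by rewrite -qEF /G/= -qEF param_coord.
have cT : T x @[x --> coord i' p] --> coord i p.
  by rewrite -Tp; exact: smooth_at_continuous.
split.
  by apply: filterS2 nT (cT _ nG) => x nTx [/= +]; rewrite nTx.
have := smooth_at_comp TS _; rewrite Tp => /(_ _ _ FS) GTS.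
have jS := atlas_transition SB jp j'p; rewrite -Gp -Tp in jS.
apply: near_eq_smooth_at (smooth_at_comp GTS jS).
apply: filterS2 nT (cT _ nG) => x nTx [/= _ E].
by rewrite /= -[coord j _]/(G (T x)) E nTx.
Qed.

Lemma smooth_mapP (F : M -> N) : smooth_map A B F -> forall p, smooth_map_at A
  B F p.
Proof.
move=> FS p; have [i [j [W [[ip oW Wp _] WF FW]]]] := FS p.
have nW : nbhs (coord i p) W by apply: open_nbhs_nbhs.
apply: (smooth_map_at_chart ip _ _ (smooth_onE oW FW Wp)).
  by have := WF _ Wp; rewrite param_coord.
exact: filterS nW.
Qed.

Lemma smooth_fun_at_chart (f : M -> R) p (i : chart_idx A) :
  dom i p -> smooth_at (f \o param A i p : 'rV[R]_n -> R^o) (coord i p) ->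
  smooth_fun_at A f p.
Proof.
move=> ip fS i' i'p.
have TS : smooth_at (coord i \o param A i' p) (coord i' p) by exact:
  atlas_transition.
have := smooth_at_comp_real TS _; rewrite /= param_coord// => /(_ _ fS).
apply: near_eq_smooth_at; apply: filterS (near_overlap SA i'p ip) => x [_ ipx
  _].
by rewrite /= param_coord.
Qed.

Lemma smooth_funP (f : M -> R) : smooth_fun A f <-> forall p, smooth_fun_at A f
  p.
Proof.
split=> fS p.
  have [i [W [[ip oW Wp _] fW]]] := fS p.
  exact: smooth_fun_at_chart (smooth_onE oW fW Wp).
have ip := atlas_dom_chart_at SA p.
have [W [oW Wp] fW] := fS p _ ip.
exists (chart_at A p), (W `&` (coord (chart_at A p) @` dom (chart_at A p))^°).
split; last by apply: smooth_onW fW => x [].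
split=> //.
- exact: openI oW (@open_interior _ _).
- by split=> //; have := atlas_overlap SA ip ip; rewrite setIid.
- by move=> x [_ /interior_subset].
Qed.

Lemma smooth_map_at_param_near (F : M -> N) p (i : chart_idx A) (j : chart_idx
  B) :
  smooth_map_at A B F p -> dom i p -> dom j (F p) ->
  \forall x \near coord i p,
    param B j (F p) (coord j (F (param A i p x))) = F (param A i p x).
Proof.
move=> FS ip jp; apply: filterS (FS i j ip jp).1 => x jx.
by rewrite param_coord.
Qed.

End OneMap.

Lemma smooth_map_at_id n M (A : atlas R n M) p : smooth_atlas A ->
  smooth_map_at A A id p.
Proof.
move=> SA i j ip jp; split; last exact: atlas_transition.
by apply: filterS (near_overlap SA ip jp) => x [].
Qed.

Section TwoMaps.
Context {n k l : nat} {M N P : Type}.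
Context {A : atlas R n M} {B : atlas R k N} {C : atlas R l P}.
Hypotheses (SA : smooth_atlas A) (SB : smooth_atlas B) (SC : smooth_atlas C).

Lemma rep_comp_near (F : M -> N) (F' : N -> P) p
    (i : chart_idx A) (j : chart_idx B) (m : chart_idx C) :
  smooth_map_at A B F p -> dom i p -> dom j (F p) ->
  \forall x \near coord i p, (coord m \o F' \o param B j (F p)) ((coord j \o F
    \o param A i p) x) =
    (coord m \o (F' \o F) \o param A i p) x.
Proof.
move=> FS ip jp; apply: filterS (smooth_map_at_param_near SB FS ip jp) => x /=
  E.
by rewrite E.
Qed.

Lemma smooth_map_at_comp (F : M -> N) (F' : N -> P) p :
  smooth_map_at A B F p -> smooth_map_at B C F' (F p) ->
  smooth_map_at A C (F' \o F) p.
Proof.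
move=> FS F'S i m ip mp.
pose j := chart_at B (F p); have jp : dom j (F p) by exact: atlas_dom_chart_at.
have [ndom FSp] := FS i j ip jp; have [ndom' FSp'] := F'S j m jp mp.
have E : (coord j \o F \o param A i p) (coord i p) = coord j (F p).
  by rewrite /= param_coord.
have cF : (coord j \o F \o param A i p) x @[x --> coord i p] --> coord j (F p).
  by rewrite -E; exact: smooth_at_continuous.
split.
  have nF := smooth_map_at_param_near SB FS ip jp.
  by have := cF _ ndom'; apply: filterS2 nF => x /= ->.
rewrite -E in FSp'.
apply: near_eq_smooth_at (smooth_at_comp FSp FSp').
exact: rep_comp_near.
Qed.

Lemma smooth_fun_at_comp (F : M -> N) (f : N -> R) p :
  smooth_map_at A B F p -> smooth_fun_at B f (F p) -> smooth_fun_at A (f \o F)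
    p.
Proof.
move=> FS fS i ip.
pose j := chart_at B (F p); have jp : dom j (F p) by exact: atlas_dom_chart_at.
have [ndom FSp] := FS i j ip jp; have fSp := fS j jp.
have E : (coord j \o F \o param A i p) (coord i p) = coord j (F p).
  by rewrite /= param_coord.
rewrite -E in fSp.
apply: near_eq_smooth_at (smooth_at_comp_real FSp fSp).
by apply: filterS (smooth_map_at_param_near SB FS ip jp) => x /= ->.
Qed.

(** The chain rule with arbitrary charts at the three points: with one of the maps equal to the
    identity it becomes a rule for changing charts. *)
Lemma diff_rep_comp (F : M -> N) (F' : N -> P) p
    (i : chart_idx A) (j : chart_idx B) (m : chart_idx C) w :
  smooth_map_at A B F p -> smooth_map_at B C F' (F p) ->
  dom i p -> dom j (F p) -> dom m (F' (F p)) ->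
  'd (coord m \o (F' \o F) \o param A i p) (coord i p) w =
  'd (coord m \o F' \o param B j (F p)) (coord j (F p))
    ('d (coord j \o F \o param A i p) (coord i p) w).
Proof.
move=> FS F'S ip jp mp.
have [ndom FSp] := FS i j ip jp; have [ndom' FSp'] := F'S j m jp mp.
have E : (coord j \o F \o param A i p) (coord i p) = coord j (F p).
  by rewrite /= param_coord.
rewrite -E in FSp' *.
rewrite (diff_near_eq (rep_comp_near _ _ FS ip jp)); last first.
  by apply: differentiable_comp; exact: smooth_at_diff.
by rewrite diff_comp//; exact: smooth_at_diff.
Qed.

Lemma diff_fun_rep_comp (F : M -> N) (f : N -> R) p (i : chart_idx A) (j :
  chart_idx B) w :
  smooth_map_at A B F p -> smooth_fun_at B f (F p) -> dom i p -> dom j (F p) ->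
  'd ((f \o F) \o param A i p : 'rV[R]_n -> R^o) (coord i p) w =
  'd (f \o param B j (F p) : 'rV[R]_k -> R^o) (coord j (F p))
    ('d (coord j \o F \o param A i p) (coord i p) w).
Proof.
move=> FS fS ip jp.
have [ndom FSp] := FS i j ip jp; have fSp := fS j jp.
have E : (coord j \o F \o param A i p) (coord i p) = coord j (F p).
  by rewrite /= param_coord.
rewrite -E in fSp *.
have nE : \forall x \near coord i p, ((f \o param B j (F p)) \o (coord j \o F
  \o param A i p)) x =
    ((f \o F) \o param A i p) x.
  by apply: filterS (smooth_map_at_param_near SB FS ip jp) => x /= ->.
rewrite (@diff_near_eq _ _ R^o _ _ _ nE); last first.
  by apply: differentiable_comp; exact: smooth_at_diff.
by rewrite diff_comp//; exact: smooth_at_diff.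
Qed.

Lemma tmap_comp (F : M -> N) (F' : N -> P) p v :
  smooth_map_at A B F p -> smooth_map_at B C F' (F p) ->
  tmap A C (F' \o F) p v = tmap B C F' (F p) (tmap A B F p v).
Proof. by move=> FS F'S; rewrite !lfunE; apply: diff_rep_comp => //; exact:
  atlas_dom_chart_at. Qed.

Lemma dfun_comp (F : M -> N) (f : N -> R) p v :
  smooth_map_at A B F p -> smooth_fun_at B f (F p) ->
  dfun A (f \o F) p v = dfun B f (F p) (tmap A B F p v).
Proof. by move=> FS F'S; rewrite !lfunE; apply: diff_fun_rep_comp => //; exact:
  atlas_dom_chart_at. Qed.

End TwoMaps.

Lemma dfunE n (M : Type) (A : atlas R n M) (f : M -> R) p v : dfun A f p v =
  'd (f \o param A (chart_at A p) p : 'rV[R]_n -> R^o) (coord (chart_at A p) p)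
    v.
Proof. by rewrite lfunE. Qed.

Section Frames.
Context {n k : nat} {M N : Type} {A : atlas R n M} {B : atlas R k N}.
Hypotheses (SA : smooth_atlas A) (SB : smooth_atlas B).

(** Both sides are the differential of F read from the chart i to the preferred chart at F p,
    factored once as F o id and once as id o F. *)
Lemma tmap_chart (F : M -> N) p (i : chart_idx A) (j : chart_idx B) w :
  smooth_map_at A B F p -> dom i p -> dom j (F p) ->
  tmap A B F p (from_chart i p w) =
  from_chart j (F p) ('d (coord j \o F \o param A i p) (coord i p) w).
Proof.
move=> FS ip jp; rewrite !lfunE.
have cp := atlas_dom_chart_at SA p; have cFp := atlas_dom_chart_at SB (F p).
have E1 := diff_rep_comp SA SA w (smooth_map_at_id SA) FS ip cp cFp.
have E2 := diff_rep_comp SA SB w FS (smooth_map_at_id SB) ip jp cFp.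
exact: etrans (esym E1) E2.
Qed.

Lemma dfun_chart (f : M -> R) p (i : chart_idx A) w : smooth_fun_at A f p ->
  dom i p ->
  dfun A f p (from_chart i p w) = 'd (f \o param A i p : 'rV[R]_n -> R^o)
    (coord i p) w.
Proof.
move=> fS ip; rewrite !lfunE.
have cp := atlas_dom_chart_at SA p.
exact: esym (diff_fun_rep_comp SA SA w (smooth_map_at_id SA) fS ip cp).
Qed.

End Frames.

Section Identity.
Context {n : nat} {M : Type} {A : atlas R n M}.
Hypotheses (SA : smooth_atlas A).

Lemma diff_rep_id p (i : chart_idx A) w : dom i p ->
  'd (coord i \o id \o param A i p) (coord i p) w = w.
Proof.
move=> ip.
rewrite (@diff_near_eq _ _ _ id); first by rewrite diff_val.
  by apply: filterS (near_param SA ip) => x [_ /= ->].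
exact/smooth_at_diff/smooth_at_id.
Qed.

Lemma from_chart_at p w : from_chart (chart_at A p) p w = w.
Proof. rewrite lfunE; exact/diff_rep_id/atlas_dom_chart_at. Qed.

Lemma from_chartK p (i : chart_idx A) : dom i p -> cancel (from_chart i p)
  (to_chart i p).
Proof.
move=> ip w; rewrite !lfunE.
have cp := atlas_dom_chart_at SA p; have idS : smooth_map_at A A id p by exact:
  smooth_map_at_id.
have E := diff_rep_comp SA SA w idS idS ip cp ip.
exact: etrans (esym E) (diff_rep_id w ip).
Qed.

Lemma to_chartK p (i : chart_idx A) : dom i p -> cancel (to_chart i p)
  (from_chart i p).
Proof.
move=> ip w; rewrite !lfunE.
have cp := atlas_dom_chart_at SA p; have idS : smooth_map_at A A id p by exact:
  smooth_map_at_id.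
have E := diff_rep_comp SA SA w idS idS cp ip cp.
exact: etrans (esym E) (diff_rep_id w cp).
Qed.

Lemma tmap_id p v : tmap A A id p v = v.
Proof. by rewrite lfunE; apply: diff_rep_id; exact: atlas_dom_chart_at. Qed.

Lemma coord_vectorE p (i : chart_idx A) l :
  coord_vector i p l = from_chart i p (delta_mx 0 l).
Proof. by []. Qed.

Lemma from_chart_coord_vector p (i : chart_idx A) w :
  from_chart i p w = \sum_l w 0 l *: coord_vector i p l.
Proof.
by rewrite [in LHS](row_sum_delta w) linear_sum; apply: eq_bigr => l _; rewrite
  linearZ.
Qed.

Lemma from_chart_change p (i j : chart_idx A) w : dom i p -> dom j p ->
  from_chart i p w = from_chart j p ('d (coord j \o param A i p) (coord i p) w).
Proof.
move=> ip jp.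
have idS : smooth_map_at A A id p by exact: smooth_map_at_id.
exact: etrans (esym (tmap_id p _)) (tmap_chart SA SA w idS ip jp).
Qed.

(** At a nearby point [dfun] uses a representative with another base point in [param]. Replacing it
    by the one based at p makes the components of df partial derivatives of a single function, which
    can be differentiated again. *)
Lemma dfun_chart_near (f : M -> R) p (i : chart_idx A) :
  (forall q, smooth_fun_at A f q) -> dom i p -> \forall x \near coord i p,
  forall w, dfun A f (param A i p x) (from_chart i (param A i p x) w) =
    'D_w (f \o param A i p : 'rV[R]_n -> R^o) x.
Proof.
move=> fS ip; apply: filterS (near_param SA ip) => x [ix Ex] w.
rewrite (dfun_chart SA w (@fS _) ix) -(deriveE _ (smooth_at_diff (fS _ _ ix)))
  Ex.
apply: near_eq_derive.
have := near_param_base SA ix; rewrite Ex; apply: filterS => y /= E.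
by rewrite /= (E p).
Qed.

End Identity.
End SmoothMaps.

(** * Product and cotangent atlases *)

Section Submx.
Context {R : realType} {n k : nat}.

Lemma near_lsubmx (x : 'rV[R]_(n + k)) (P : 'rV[R]_n -> Prop) :
  (\forall y \near lsubmx x, P y) -> \forall y \near x, P (lsubmx y).
Proof. by move=> nP; exact: (@continuous_lsubmx R 1 n k x _ nP). Qed.

Lemma near_rsubmx (x : 'rV[R]_(n + k)) (P : 'rV[R]_k -> Prop) :
  (\forall y \near rsubmx x, P y) -> \forall y \near x, P (rsubmx y).
Proof. by move=> nP; exact: (@continuous_rsubmx R 1 n k x _ nP). Qed.

End Submx.

Section ProdAtlas.
Context {R : realType} {n k : nat} {M N : Type}.
Context {A : atlas R n M} {B : atlas R k N}.
Hypotheses (SA : smooth_atlas A) (SB : smooth_atlas B).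
Local Notation AB := (prod_atlas A B).

Lemma prod_coord_inj (i : chart_idx AB) : {in dom i &, injective (coord i)}.
Proof.
move=> [p q] [p' q']; rewrite !inE/= => -[ip iq] [ip' iq'] /eq_row_mx[/= E1 E2].
congr pair; first by apply: (atlas_coord_inj SA) E1; rewrite inE.
by apply: (atlas_coord_inj SB) E2; rewrite inE.
Qed.

Lemma prod_overlap (i j : chart_idx AB) p : dom i p -> dom j p ->
  nbhs (coord i p) (coord i @` (dom i `&` dom j)).
Proof.
move=> [ip1 ip2] [jp1 jp2] /=.
have n1 := atlas_overlap SA ip1 jp1; have n2 := atlas_overlap SB ip2 jp2.
rewrite -[coord i.1 p.1](row_mxKl _ (coord i.2 p.2)) in n1.
rewrite -[coord i.2 p.2](row_mxKr (coord i.1 p.1)) in n2.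
apply: filterS2 (near_lsubmx n1) (near_rsubmx n2) => x [q1 [iq1 jq1] E1] [q2
  [iq2 jq2] E2].
by exists (q1, q2) => //=; rewrite E1 E2 hsubmxK.
Qed.

Lemma prod_near_param (i : chart_idx AB) p : dom i p -> \forall x \near coord i
  p,
  param AB i p x = (param A i.1 p.1 (lsubmx x), param B i.2 p.2 (rsubmx x)).
Proof.
move=> ip; apply: filterS (prod_overlap ip ip) => _ [q [[iq1 iq2] _] <-].
rewrite row_mxKl row_mxKr (param_coord SA)// (param_coord SB)//
  -surjective_pairing.
exact: (inj_param_coord p (prod_coord_inj (i := i))).
Qed.

Lemma prod_smooth_atlas : smooth_atlas AB.
Proof.
split=> [p|i|i j p|i j p ip jp].
- by split=> /=; exact: atlas_dom_chart_at.
- exact: prod_coord_inj.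
- exact: prod_overlap.
apply: (@near_eq_smooth_at _ _ _ (fun x => row_mx ((coord j.1 \o param A i.1
  p.1) (lsubmx x))
    ((coord j.2 \o param B i.2 p.2) (rsubmx x)))).
  by apply: filterS (prod_near_param ip) => x /= ->.
apply: smooth_at_row_mx.
  apply: (@smooth_at_comp _ _ _ _ lsubmx); first
    exact/smooth_at_lsubmx/smooth_at_id.
  by rewrite row_mxKl; apply: atlas_transition => //; [exact: ip.1|exact: jp.1].
apply: (@smooth_at_comp _ _ _ _ rsubmx); first
  exact/smooth_at_rsubmx/smooth_at_id.
by rewrite row_mxKr; apply: atlas_transition => //; [exact: ip.2|exact: jp.2].
Qed.

End ProdAtlas.

Section Dot.
Context {R : realType} {n : nat}.

(** Here p is a covector and w a vector, and linearity is registered in w. *)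
Definition dot (p w : 'rV[R]_n) : R^o := \sum_k w 0 k * p 0 k.

Lemma dot_is_linear p : linear (dot p).
Proof.
move=> c u v; rewrite /dot scaler_sumr -big_split/=; apply: eq_bigr => k _.
by rewrite !mxE mulrDl -mulrA.
Qed.

HB.instance Definition _ p := GRing.isLinear.Build R 'rV[R]_n R^o *:%R (dot p)
  (dot_is_linear p).

Lemma dot_delta p k : dot p (delta_mx 0 k) = p 0 k.
Proof.
rewrite /dot (bigD1 k)//= big1 ?addr0; first by rewrite mxE !eqxx mul1r.
by move=> l lk; rewrite mxE (negbTE lk) andbF mul0r.
Qed.

Lemma dot0l w : dot 0 w = 0.
Proof. by rewrite /dot big1// => k _; rewrite mxE mulr0. Qed.

End Dot.

Section CotangentAtlas.
Context {R : realType} {n : nat} {Q : topologicalType}.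
Context {AQ : atlas R n Q}.
Hypothesis SQ : smooth_atlas AQ.
Local Notation AT := (cotangent_atlas AQ).
Local Notation cotangent := (cotangent R n Q).
Local Notation domT i := (@dom R (n + n) cotangent AT i).
Local Notation coordT i := (@coord R (n + n) cotangent AT i).
Local Notation paramT i := (@param R (n + n) cotangent AT i).
Implicit Types (i j : chart_idx AQ) (q : Q) (a : cotangent).

(** The covector at q with momentum coordinates p in the chart i; it inverts the fibre part of the
    canonical chart. *)
Definition covector i q (p : 'rV[R]_n) : 'Hom('rV[R]_n, R^o) :=
  (linfun (dot p) \o to_chart i q)%VF.

Lemma covectorE i q p w : dom i q ->
  covector i q p (from_chart i q w) = dot p w.
Proof. by move=> iq; rewrite comp_lfunE lfunE/= from_chartK. Qed.

Lemma cotangent_fromE a i w :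
  a.2 (from_chart i a.1 w) = dot (rsubmx (coordT i a)) w.
Proof.
rewrite /= row_mxKr from_chart_coord_vector linear_sum.
by apply: eq_bigr => k _; rewrite mxE linearZ.
Qed.

Lemma cotangent_coord_covector i q p : dom i q ->
  coordT i (q, covector i q p) = row_mx (coord i q) p.
Proof.
move=> iq /=; congr row_mx; apply/rowP => k.
by rewrite mxE covectorE// dot_delta.
Qed.

Lemma cotangent_coord_inj i : {in domT i &, injective (coordT i)}.
Proof.
move=> a a'; rewrite !inE => ia ia' E; have /eq_row_mx[E1 _] := E.
have {}E1 : a.1 = a'.1 by apply: (atlas_coord_inj SQ) E1; rewrite inE.
rewrite [a]surjective_pairing [a']surjective_pairing -E1; congr pair.
apply/lfunP => v; rewrite -(to_chartK SQ ia v) cotangent_fromE [in RHS]E1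
  cotangent_fromE.
by rewrite E E1.
Qed.

Lemma cotangent_overlap i j a : domT i a -> domT j a ->
  nbhs (coordT i a) (coordT i @` (domT i `&` domT j)).
Proof.
move=> ia ja; have n1 := atlas_overlap SQ ia ja.
rewrite -[coord _ a.1](row_mxKl _ (\row_k (a.2 (coord_vector i a.1 k) : R))) in
  n1.
apply: filterS (near_lsubmx n1) => x [q [iq jq] E].
exists (q, covector i q (rsubmx x)) => //.
by rewrite cotangent_coord_covector// E hsubmxK.
Qed.

Lemma cotangent_near_param i a : dom i a.1 -> \forall x \near coordT i a,
  let q := param AQ i a.1 (lsubmx x) in
  [/\ dom i q, coord i q = lsubmx x & paramT i a x = (q, covector i q (rsubmx
    x))].
Proof.
move=> ia; apply: filterS (cotangent_overlap ia ia) => _ [c [ic _] <-].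
rewrite /= row_mxKl (param_coord SQ)//; split=> //.
rewrite -/(coordT i c) (inj_param_coord a (@cotangent_coord_inj i))//.
apply: (@cotangent_coord_inj i); rewrite ?inE//.
by rewrite cotangent_coord_covector// row_mxKr.
Qed.

Lemma derive_param_base n' i p q (F : Q -> 'rV[R]_n') w :
  dom i p -> dom i q ->
  smooth_at (F \o param AQ i q) (coord i q) ->
  'd (F \o param AQ i q) (coord i q) w = 'D_w (F \o param AQ i p) (coord i q).
Proof.
move=> ip iq /smooth_at_diff FS; rewrite -(deriveE _ FS); apply: near_eq_derive.
by apply: filterS (near_param_base SQ iq) => x /= ->.
Qed.

(** The new momenta are p'_k = sum_l (dx_l / dx'_k) p_l, with the Jacobian of the inverse transition
    taken at the new position; [P] is this expression. *)
Lemma cotangent_transition i j a : dom i a.1 -> dom j a.1 ->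
  smooth_at (coordT j \o paramT i a) (coordT i a).
Proof.
move=> ia ja.
pose T := coord j \o param AQ i a.1.
pose T' := coord i \o param AQ j a.1.
pose P (k : 'I_n) x : R^o := \sum_l 'D_(delta_mx 0 k) T' (T (lsubmx x)) 0 l *
  rsubmx x 0 l.
apply: (@near_eq_smooth_at _ _ _ (fun x => row_mx (T (lsubmx x)) (\row_k P k
  x))).
  have n1 : \forall x \near lsubmx (coordT i a), [/\ dom i (param AQ i a.1 x),
      dom j (param AQ i a.1 x) & coord i (param AQ i a.1 x) = x].
    by rewrite row_mxKl; exact: (near_overlap SQ ia ja).
  apply: filterS2 (near_lsubmx n1) (cotangent_near_param ia) => x [ix jx Ex] [_
    _ Ep].
  rewrite [RHS]/= Ep /=; congr row_mx; apply/rowP => k; rewrite !mxE.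
  rewrite /coord_vector (from_chart_change SQ _ jx ix) covectorE//.
  by rewrite (derive_param_base _ ja jx)//; exact: atlas_transition.
have lS : smooth_at (@lsubmx R 1 n n) (coordT i a) by
  exact/smooth_at_lsubmx/smooth_at_id.
have TS : smooth_at (T \o lsubmx) (coordT i a).
  by apply: smooth_at_comp => //; rewrite /= row_mxKl; exact: atlas_transition.
apply: smooth_at_row_mx => //.
apply/smooth_at_rowP => k.
apply: (@near_eq_smooth_at _ _ _ (P k)); first by near=> x; rewrite mxE.
apply: smooth_at_sum => l; apply: smooth_atM.
  apply: smooth_at_coord.
  apply: (@smooth_at_comp _ _ _ _ (T \o lsubmx) ('D_(delta_mx 0 k) T')) => //.
  apply: smooth_at_derive; rewrite /T /= row_mxKl param_coord//.
  exact: atlas_transition.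
exact/smooth_at_coord/smooth_at_rsubmx/smooth_at_id.
Unshelve. all: by end_near. Qed.

Lemma cotangent_smooth_atlas : smooth_atlas AT.
Proof.
split=> [a|i|i j a|i j a].
- exact: (atlas_dom_chart_at SQ).
- exact: cotangent_coord_inj.
- exact: cotangent_overlap.
- exact: cotangent_transition.
Qed.

End CotangentAtlas.

(** * The atlas of the dual vertical bundle *)

(* Unification otherwise unfolds these down to limits, and does not end. *)
Local Opaque coord_vector from_chart to_chart tmap dfun param.

Section VdualAtlas.
Context {R : realType} {n : nat} {Q : topologicalType}.
Context {AQ : atlas R n.+1 Q} {Pi : Q -> R}.
Hypothesis SQ : smooth_atlas AQ.
Hypothesis SPi : forall p, smooth_fun_at AQ Pi p.
Hypothesis Pi_submersion : forall q, limg (eta AQ Pi q) = fullv.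
Local Notation cotangent := (cotangent R n.+1 Q).
Local Notation AT := (cotangent_atlas AQ).
Local Notation domT i := (@dom R (n.+1 + n.+1) cotangent AT i).
Local Notation coordT i := (@coord R (n.+1 + n.+1) cotangent AT i).
Local Notation paramT i := (@param R (n.+1 + n.+1) cotangent AT i).
Local Notation vdual := (vdual AQ Pi).
Local Notation AV := (vdual_atlas AQ Pi).
Local Notation eta := (eta AQ Pi).
Local Notation mu := (mu AQ Pi).
Implicit Types (i : chart_idx AQ) (q : Q) (a : cotangent) (b : vdual) (k :
  'I_n.+1).

Definition veval b (v : 'rV[R]_n.+1) : R^o := projT2 b (vsproj (vertical AQ Pi
  (tau b)) v).

Lemma veval_mu a v : eta a.1 v = 0 -> veval (mu a) v = a.2 v.
Proof. by move=> v0; rewrite /veval/= comp_lfunE lfunE/= vsprojK// memv_ker v0.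
  Qed.

Lemma eq_mu a a' : a.1 = a'.1 -> (forall v, eta a.1 v = 0 -> a.2 v = a'.2 v) ->
  mu a = mu a'.
Proof.
case: a a' => [q f] [q' f'] /= <-{q'} ff'; congr existT.
apply/lfunP => u; rewrite !comp_lfunE !lfunE/=; apply: ff'.
by apply/eqP; rewrite -memv_ker; exact: subvsP.
Qed.

Lemma mu_inj a a' v : mu a = mu a' -> eta a.1 v = 0 -> a.2 v = a'.2 v.
Proof.
move=> E v0; have E1 : a.1 = a'.1 := congr1 (@tau _ _ _ _ _) E.
have v0' : eta a'.1 v = 0 by rewrite -E1.
rewrite -(veval_mu v0) -(veval_mu v0').
exact: (congr1 (veval^~ v) E).
Qed.

Lemma eta_eq1 q : exists v, eta q v = 1.
Proof.
have : (1 : R^o) \in limg (eta q) by rewrite Pi_submersion memvf.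
by move=> /memv_imgP[v _ ->]; exists v.
Qed.

(** For v with eta(v) = 1, every w - eta(w) v is vertical, so a - a' vanishes on it; hence s = (a -
    a')(v). *)
Lemma mu_eq_eta a a' : mu a = mu a' -> exists s, a.2 - a'.2 = s *: eta a.1.
Proof.
move=> E; have [v v1] := eta_eq1 a.1; exists ((a.2 - a'.2) v).
apply/lfunP => w; rewrite scale_lfunE !add_lfunE !opp_lfunE; apply/eqP; rewrite
  -subr_eq0; apply/eqP.
have : a.2 (w - (eta a.1 w) *: v) = a'.2 (w - (eta a.1 w) *: v).
  by apply: mu_inj E _; rewrite linearB linearZ/= v1 [_ *: _]mulr1 subrr.
rewrite !linearB !linearZ/= => E'.
have aux (x y z t e : R) : x + e * - z = y + e * - t -> x - y + (z - t) * - e =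
  0 by move=> *; lra.
exact: aux E'.
Qed.

Lemma mu_surj b : exists a, mu a = b.
Proof.
exists (tau b, (projT2 b \o linfun (vsproj (vertical AQ Pi (tau b))))%VF).
case: b => q f; rewrite /mu /=; congr existT.
by apply/lfunP => u; rewrite !comp_lfunE !lfunE/= vsvalK.
Qed.

Definition eta_coef i l q : R := eta q (coord_vector i q l).

(** In the chart i these coefficients are the partial derivatives of Pi. *)
Lemma eta_coef_smooth i l p : dom i p -> smooth_fun_at AQ (eta_coef i l) p.
Proof.
move=> ip; apply: (smooth_fun_at_chart SQ ip).
have := smooth_at_derive (delta_mx 0 l) (SPi ip); apply: near_eq_smooth_at.
by apply: filterS (dfun_chart_near SQ SPi ip) => x Dx; rewrite /= /eta_coef
  coord_vectorE [RHS]Dx.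
Qed.

Lemma vertical_frameE i k q j : vertical_frame Pi i k q j =
  coord_vector i q (lift k j) -
  (eta_coef i (lift k j) q / eta_coef i k q) *: coord_vector i q k.
Proof. by []. Qed.

Lemma vertical_frame_ker i k q j : eta_coef i k q != 0 -> eta q (vertical_frame
  Pi i k q j) = 0.
Proof.
move=> k0; rewrite vertical_frameE linearB linearZ.
have E : eta_coef i (lift k j) q / eta_coef i k q * eta_coef i k q = eta_coef i
  (lift k j) q.
  by rewrite divfK.
exact: etrans (congr1 (fun z => eta_coef i (lift k j) q - z) E) (subrr _).
Qed.

(** The equation eta(v) = 0 determines the k-th component of v from the others, and the remaining
    components are the coefficients in the frame. *)
Lemma vertical_frame_span i k q v : dom i q -> eta_coef i k q != 0 -> eta q v =
  0 ->
  v = \sum_j to_chart i q v 0 (lift k j) *: vertical_frame Pi i k q j.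
Proof.
move=> iq k0 v0; set w := to_chart i q v.
have vE : v = w 0 k *: coord_vector i q k +
    \sum_j w 0 (lift k j) *: coord_vector i q (lift k j).
  by rewrite -[LHS](to_chartK SQ iq) from_chart_coord_vector (bigD1_ord k).
have E : w 0 k * eta_coef i k q + \sum_j w 0 (lift k j) * eta_coef i (lift k j)
  q = 0.
  rewrite -[RHS]v0 [in RHS]vE linearD linearZ; congr (_ + _).
  by rewrite linear_sum; apply: eq_bigr => j _; rewrite linearZ.
have wk : w 0 k = - \sum_j w 0 (lift k j) * (eta_coef i (lift k j) q / eta_coef
  i k q).
  apply: (mulIf k0); rewrite mulNr mulr_suml; apply/eqP; rewrite -addr_eq0;
    apply/eqP.
  rewrite -[RHS]E; congr (_ + _); apply: eq_bigr => j _.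
  by rewrite -mulrA divfK.
rewrite [LHS]vE wk scaleNr scaler_suml addrC -sumrN -big_split/=; apply:
  eq_bigr => j _.
by rewrite vertical_frameE scalerBr scalerA.
Qed.

Definition vdom (ik : chart_idx AQ * 'I_n.+1) b :=
  dom ik.1 (tau b) /\ eta_coef ik.1 ik.2 (tau b) != 0.

Lemma vdomP (ik : chart_idx AV) b : dom ik b <-> vdom ik b.
Proof. by split => -[? /eqP ?]; split=> //; apply/eqP. Qed.

(** The projection mu from canonical coordinates to the chart (i, k): the new fibre coordinates are
    the values of the covector on the vertical frame. The point p serves only as base point of
    [param]. *)
Definition mu_loc i k p (x : 'rV[R]_(n.+1 + n.+1)) : 'rV[R]_(n.+1 + n) :=
  let q := param AQ i p (lsubmx x) in
  row_mx (lsubmx x) (\row_j (rsubmx x 0 (lift k j) -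
    eta_coef i (lift k j) q / eta_coef i k q * rsubmx x 0 k)).

Lemma mu_locE i k p a : dom i a.1 -> eta_coef i k a.1 != 0 ->
  @coord _ _ _ AV (i, k) (mu a) = mu_loc i k p (coordT i a).
Proof.
move=> ia k0; rewrite /mu_loc/= row_mxKl row_mxKr param_coord//.
congr row_mx; apply/rowP => j; rewrite !mxE.
transitivity (a.2 (vertical_frame Pi i k a.1 j)).
  exact: (veval_mu (vertical_frame_ker j k0)).
by rewrite vertical_frameE linearB linearZ.
Qed.

Lemma mu_loc_smooth i k p x : dom i p -> eta_coef i k p != 0 -> lsubmx x =
  coord i p ->
  smooth_at (mu_loc i k p) x.
Proof.
move=> ip k0 xp.
have lS : smooth_at (@lsubmx R 1 n.+1 n.+1) x by
  exact/smooth_at_lsubmx/smooth_at_id.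
have rS : smooth_at (@rsubmx R 1 n.+1 n.+1) x by
  exact/smooth_at_rsubmx/smooth_at_id.
have cS l : smooth_at (fun x : 'rV[R]_(n.+1 + n.+1) => eta_coef i l (param AQ i
  p (lsubmx x)) : R^o) x.
  apply: (@smooth_at_comp_real _ _ _ lsubmx (eta_coef i l \o param AQ i p)) =>
    //.
  by rewrite xp; exact: eta_coef_smooth.
apply: smooth_at_row_mx => //.
apply/smooth_at_rowP => j.
apply: (@near_eq_smooth_at _ _ _ (fun x : 'rV[R]_(n.+1 + n.+1) => rsubmx x 0
  (lift k j) -
    eta_coef i (lift k j) (param AQ i p (lsubmx x)) / eta_coef i k (param AQ i
    p (lsubmx x)) * rsubmx x 0 k : R^o)).
  by near=> y; rewrite [RHS]mxE.
apply: smooth_atB; first exact: smooth_at_coord.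
apply: smooth_atM; last exact: smooth_at_coord.
apply: smooth_atM; first exact: cS.
by apply: smooth_atV; [rewrite xp param_coord|exact: cS].
Unshelve. all: by end_near. Qed.

(** The section of [mu_loc] with k-th momentum zero: it extends a functional on vertical vectors by
    zero on d/dx^k. Through it the atlas of V^*Pi is studied inside T^*Q. *)
Definition mu_sec k (z : 'rV[R]_(n.+1 + n)) : 'rV[R]_(n.+1 + n.+1) :=
  row_mx (lsubmx z) (\row_l oapp (fun j => rsubmx z 0 j) 0 (unlift k l)).

Lemma mu_locK i k p : cancel (mu_sec k) (mu_loc i k p).
Proof.
move=> z; rewrite /mu_loc/mu_sec row_mxKl row_mxKr -[RHS]hsubmxK; congr row_mx.
by apply/rowP => j; rewrite !mxE liftK unlift_none/= mulr0 subr0 !mxE.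
Qed.

Lemma hsubmxK_sec k z : row_mx (lsubmx z) (rsubmx (mu_sec k z)) = mu_sec k z.
Proof. by rewrite /mu_sec row_mxKr. Qed.

Lemma mu_sec_smooth k z : smooth_at (mu_sec k) z.
Proof.
apply: smooth_at_row_mx; first exact/smooth_at_lsubmx/smooth_at_id.
apply/smooth_at_rowP => l; under eq_fun do rewrite mxE.
case: (unlift k l) => [j|] /=; last exact: smooth_at_cst.
exact/smooth_at_coord/smooth_at_rsubmx/smooth_at_id.
Qed.

(** Lifted to T^*Q, the two functionals agree on the vertical frame, hence on all vertical
    vectors. *)
Lemma vdual_coord_inj (ik : chart_idx AV) : {in dom ik &, injective (coord ik)}.
Proof.
case: ik => i k b b' /set_mem Hb /set_mem Hb' /eq_row_mx[E1 E2].
have [[/= ib kb] [/= ib' kb']] := ((vdomP _ _).1 Hb, (vdomP _ _).1 Hb').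
have {}E1 : tau b = tau b' by apply: (atlas_coord_inj SQ) E1; rewrite inE.
have [[a Ea] [a' Ea']] := (mu_surj b, mu_surj b').
subst b b'.
rewrite /= in E1 ib kb ib' kb' E2 *.
apply: (eq_mu E1) => v v0.
rewrite (vertical_frame_span ib kb v0) !linear_sum; apply: eq_bigr => j _.
rewrite [LHS]linearZ [RHS]linearZ.
apply: (congr1 (fun z => to_chart i a.1 v 0 (lift k j) * z)).
move/rowP/(_ j): E2; rewrite [LHS]mxE [RHS]mxE => E2j.
apply: etrans (esym (veval_mu (vertical_frame_ker j kb))) (etrans E2j _).
rewrite E1; exact: (veval_mu (vertical_frame_ker j kb')).
Qed.

Definition mu_lift i k b : cotangent :=
  (tau b, covector i (tau b) (rsubmx (mu_sec k (@coord _ _ _ AV (i, k) b)))).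

Lemma mu_lift_coord i k b : dom i (tau b) ->
  coordT i (mu_lift i k b) = mu_sec k (@coord _ _ _ AV (i, k) b).
Proof.
move=> ib; rewrite cotangent_coord_covector//.
by rewrite -[RHS]hsubmxK row_mxKl row_mxKl.
Qed.

Lemma near_eta_coef i j l p : dom i p -> dom j p -> eta_coef j l p != 0 ->
  \forall x \near coord i p, eta_coef j l (param AQ i p x) != 0.
Proof.
move=> ip jp l0; have := smooth_at_continuous (eta_coef_smooth l jp ip).
move=> c; apply: (c [set y : R | y != 0]).
by rewrite /= param_coord//; apply: open_nbhs_nbhs; split=> //; exact: open_neq.
Qed.

(** The fibre coordinates are unrestricted, so only the base part of z has to be close: the covector
    c with coordinates [mu_sec k z] gives a point [mu c] with coordinates z. *)
Lemma vdual_overlap (ik jl : chart_idx AV) b : dom ik b -> dom jl b ->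
  nbhs (coord ik b) (coord ik @` (dom ik `&` dom jl)).
Proof.
case: ik jl => [i k] [j l] Hb Hb'.
have [[/= ib kb] [/= jb lb]] := ((vdomP _ _).1 Hb, (vdomP _ _).1 Hb').
pose z0 := @coord _ _ _ AV (i, k) b.
have z0E : lsubmx z0 = coord i (tau b) by rewrite /z0/= row_mxKl.
have nO : \forall y \near lsubmx z0, [/\ dom i (param AQ i (tau b) y), dom j
  (param AQ i (tau b) y)
    & coord i (param AQ i (tau b) y) = y] by rewrite z0E; exact: near_overlap.
have nk : \forall y \near lsubmx z0, eta_coef i k (param AQ i (tau b) y) != 0.
  by rewrite z0E; exact: near_eta_coef.
have nl : \forall y \near lsubmx z0, eta_coef j l (param AQ i (tau b) y) != 0.
  by rewrite z0E; exact: near_eta_coef.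
apply: filterS3 (near_lsubmx nO) (near_lsubmx nk) (near_lsubmx nl) => z [iz jz
  Ez] kz lz.
pose c : cotangent := (param AQ i (tau b) (lsubmx z),
  covector i (param AQ i (tau b) (lsubmx z)) (rsubmx (mu_sec k z))).
exists (mu c); first by split; [exact: (vdomP (i, k) _).2|exact: (vdomP (j, l)
  _).2].
apply: etrans (mu_locE (a := c) (tau b) iz kz) _.
rewrite cotangent_coord_covector//= Ez.
by rewrite hsubmxK_sec mu_locK.
Qed.

Lemma mu_lift_near_param i k b : dom i (tau b) -> \forall z \near @coord _ _ _
  AV (i, k) b,
  let q := param AQ i (tau b) (lsubmx z) in
  [/\ dom i q, coord i q = lsubmx z &
    paramT i (mu_lift i k b) (mu_sec k z) = (q, covector i q (rsubmx (mu_sec k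
    z)))].
Proof.
move=> ib; have nT := cotangent_near_param SQ (a := mu_lift i k b) ib.
rewrite mu_lift_coord// in nT.
apply: filterS (smooth_at_near_preimage (mu_sec_smooth k _) nT) => z /=.
by rewrite row_mxKl.
Qed.

(** The inverse chart of V^*Pi factors through T^*Q by means of the section [mu_sec]. *)
Lemma vdual_near_param i k b : vdom (i, k) b -> \forall z \near @coord _ _ _ AV
  (i, k) b,
  @param _ _ _ AV (i, k) b z = mu (paramT i (mu_lift i k b) (mu_sec k z)).
Proof.
move=> Hb; have [/= ib kb] := Hb.
set z0 := @coord _ _ _ AV (i, k) b.
have nT := mu_lift_near_param k ib.
have z0E : lsubmx z0 = coord i (tau b) by rewrite /z0/= row_mxKl.
have nk : \forall y \near lsubmx z0, eta_coef i k (param AQ i (tau b) y) != 0.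
  by rewrite z0E; exact: near_eta_coef.
apply: filterS3 nT (near_lsubmx nk) (vdual_overlap ((vdomP (i, k) b).2 Hb)
  ((vdomP (i, k) b).2 Hb)).
move=> z [iq Eq ->] kz [c [Hc _] cz].
set q := param AQ i (tau b) (lsubmx z) in iq Eq kz *.
pose c' : cotangent := (q, covector i q (rsubmx (mu_sec k z))); rewrite -/c'.
have -> : @param _ _ _ AV (i, k) b z = c.
  by rewrite -cz; exact: (inj_param_coord b (@vdual_coord_inj (i, k)) Hc).
apply: (@vdual_coord_inj (i, k)); first by apply: mem_set; exact: Hc.
  apply: mem_set; apply: (vdomP (i, k) _).2; split; [exact: iq|exact: kz].
apply: etrans cz (esym _).
apply: etrans (mu_locE (a := c') (tau b) iq kz) _.
rewrite (cotangent_coord_covector SQ); last exact: iq.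
by rewrite Eq hsubmxK_sec mu_locK.
Qed.

Lemma near_mu_lift i k j l b : vdom (i, k) b -> vdom (j, l) b ->
  \forall z \near @coord _ _ _ AV (i, k) b,
  let c := paramT i (mu_lift i k b) (mu_sec k z) in
  [/\ dom j c.1 & eta_coef j l c.1 != 0].
Proof.
move=> [/= ib kb] [/= jb lb].
have z0E : lsubmx (@coord _ _ _ AV (i, k) b) = coord i (tau b) by rewrite /=
  row_mxKl.
have nT := mu_lift_near_param k ib.
have nO : \forall y \near lsubmx (@coord _ _ _ AV (i, k) b),
    [/\ dom i (param AQ i (tau b) y), dom j (param AQ i (tau b) y)
    & coord i (param AQ i (tau b) y) = y] by rewrite z0E; exact: near_overlap.
have nl : \forall y \near lsubmx (@coord _ _ _ AV (i, k) b), eta_coef j l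
  (param AQ i (tau b) y) != 0.
  by rewrite z0E; exact: near_eta_coef.
apply: filterS3 nT (near_lsubmx nO) (near_lsubmx nl) => z [_ _ E] [_ jz _] lz.
by rewrite E.
Qed.

(** The transition is [mu_loc] after a transition of T^*Q after [mu_sec]; no change of vertical
    frames is computed. *)
Lemma vdual_transition (ik jl : chart_idx AV) b : dom ik b -> dom jl b ->
  smooth_at (coord jl \o param AV ik b) (coord ik b).
Proof.
case: ik jl => [i k] [j l] Hb Hb'.
have [Hb1 Hb1'] := ((vdomP (i, k) _).1 Hb, (vdomP (j, l) _).1 Hb').
have [[/= ib kb] [/= jb lb]] := (Hb1, Hb1').
set z0 := @coord _ _ _ AV (i, k) b.
have E0 : mu_sec k z0 = coordT i (mu_lift i k b) by rewrite mu_lift_coord.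
apply: (@near_eq_smooth_at _ _ _ (mu_loc j l (tau b) \o
    ((coordT j \o paramT i (mu_lift i k b)) \o mu_sec k))).
  apply: filterS2 (vdual_near_param Hb1) (near_mu_lift Hb1 Hb1') => z Ez [jz
    lz].
  pose c := paramT i (mu_lift i k b) (mu_sec k z).
  transitivity (@coord _ _ _ AV (j, l) (mu c)).
    symmetry; exact: (mu_locE (a := c) (tau b) jz lz).
  rewrite /c -Ez.
  by [].
have cS : smooth_at (coordT j \o paramT i (mu_lift i k b)) (mu_sec k z0).
  by rewrite E0; exact: cotangent_transition.
apply: smooth_at_comp; first exact: smooth_at_comp (mu_sec_smooth k z0) cS.
apply: mu_loc_smooth => //.
have -> : ((coordT j \o paramT i (mu_lift i k b)) \o mu_sec k) z0 = coordT j
  (mu_lift i k b).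
  rewrite -[LHS]/(coordT j (paramT i (mu_lift i k b) (mu_sec k z0))) E0.
  congr (coordT j _).
  exact: (param_coord (cotangent_smooth_atlas SQ) (mu_lift i k b) (ib : domT i
    (mu_lift i k b))).
by rewrite /= row_mxKl.
Qed.

Lemma vdual_smooth_atlas : smooth_atlas AV.
Proof.
split=> [b|ik|ik jl b|ik jl b].
- split; first exact: (atlas_dom_chart_at SQ).
  (* The default [ord0] never arises: if eta vanished on all coordinate vectors it would vanish on
     the v with eta(v) = 1. *)
  rewrite /=; case: pickP => [k /eqP //|k0].
  have [v] := eta_eq1 (tau b).
  rewrite -(to_chartK SQ (atlas_dom_chart_at SQ (tau b)) v)
    from_chart_coord_vector.
  rewrite linear_sum big1 => [/esym/eqP|l _]; first by rewrite oner_eq0.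
  rewrite linearZ; have /negbFE/eqP E := k0 l.
  by apply: etrans (congr1 (fun z => _ * z) E) _; rewrite mulr0.
- exact: vdual_coord_inj.
- exact: vdual_overlap.
- exact: vdual_transition.
Qed.

Lemma mu_smooth a : smooth_map_at AT AV mu a.
Proof.
have Hb := atlas_dom_chart_at vdual_smooth_atlas (mu a).
move: (chart_at AV (mu a)) Hb => [i k] Hb.
have [/= ia ka] := (vdomP (i, k) _).1 Hb.
apply: (smooth_map_at_chart (cotangent_smooth_atlas SQ) vdual_smooth_atlas (i
  := i) ia Hb).
  have n1 : \forall y \near lsubmx (coordT i a), 
      dom i (param AQ i a.1 y) /\ eta_coef i k (param AQ i a.1 y) != 0.
    rewrite /= row_mxKl; apply: filterS2 (near_param SQ ia) (near_eta_coef ia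
    ia ka).
    by move=> y [].
  apply: filterS2 (near_lsubmx n1) (cotangent_near_param SQ ia) => x [ix kx] [_
    _ ->].
  by apply: (vdomP (i, k) _).2.
apply: (@near_eq_smooth_at _ _ _ (mu_loc i k a.1)).
  have n1 : \forall y \near lsubmx (coordT i a), 
      dom i (param AQ i a.1 y) /\ eta_coef i k (param AQ i a.1 y) != 0.
    rewrite /= row_mxKl; apply: filterS2 (near_param SQ ia) (near_eta_coef ia
    ia ka).
    by move=> y [].
  apply: filterS2 (near_lsubmx n1) (cotangent_near_param SQ ia) => x [ix kx] [_
    Ex Ep].
  pose c : cotangent := (param AQ i a.1 (lsubmx x), covector i (param AQ i a.1
    (lsubmx x)) (rsubmx x)).
  transitivity (@coord _ _ _ AV (i, k) (mu c)); last by rewrite /c -Ep.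
  symmetry; apply: etrans (mu_locE (a := c) a.1 ix kx) _.
  by rewrite (cotangent_coord_covector SQ) ?Ex ?hsubmxK//; exact: ix.
by apply: mu_loc_smooth => //; rewrite /= row_mxKl.
Qed.

End VdualAtlas.

(** * The canonical symplectic form in coordinates *)

Lemma liouvilleE_def (R : realType) n (Q : topologicalType) (AQ : atlas R n Q)
  a w :
  liouville AQ a w = a.2 (tmap (cotangent_atlas AQ) AQ fst a w).
Proof. by rewrite comp_lfunE. Qed.

Section Derive.
Context {R : realType}.
Implicit Types V W : normedModType R.

(** The two difference quotients coincide term by term, so the equality holds for every g. It serves
    to pass between partial derivatives and derivatives in block directions. *)
Lemma derive_comp_affine V W (X : normedModType R) (f : V -> W) (g : W -> X) (x
  v : V) (u : W) :
  (forall h : R, f (h *: v + x) = h *: u + f x) -> 'D_v (g \o f) x = 'D_u g (f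
    x).
Proof.
move=> fE; suff E : (fun h : R => h^-1 *: (((g \o f) \o shift x) (h *: v) - (g
  \o f) x)) =
    (fun h : R => h^-1 *: ((g \o shift (f x)) (h *: u) - g (f x))) by rewrite
    /derive E.
by apply/funext => h /=; rewrite fE.
Qed.

Lemma derive_row_mxl n k V (g : 'rV[R]_(n + k) -> V) z x v :
  'D_v (fun z => g (row_mx z x)) z = 'D_(row_mx v 0) g (row_mx z x).
Proof.
apply: (@derive_comp_affine _ _ _ (fun z => row_mx z x)) => h.
by rewrite scale_row_mx add_row_mx scaler0 add0r.
Qed.

Lemma derive_row_mxr n k V (g : 'rV[R]_(n + k) -> V) z x v :
  'D_v (fun x => g (row_mx z x)) x = 'D_(row_mx 0 v) g (row_mx z x).
Proof.
apply: (@derive_comp_affine _ _ _ (fun x => row_mx z x)) => h.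
by rewrite scale_row_mx add_row_mx scaler0 add0r.
Qed.

Lemma deriveDdir V W (g : V -> W) x u v : differentiable g x ->
  'D_(u + v) g x = 'D_u g x + 'D_v g x.
Proof. by move=> dg; rewrite !(deriveE _ dg) linearD. Qed.

Lemma derive_row_mx V n k (f : V -> 'rV[R]_n) (g : V -> 'rV[R]_k) x v :
  differentiable f x -> differentiable g x ->
  'D_v (fun y => row_mx (f y) (g y)) x = row_mx ('D_v f x) ('D_v g x).
Proof.
move=> df dg.
have dfg : differentiable (fun y => row_mx (f y) (g y)) x.
  apply/differentiable_rowP => j; rewrite -(splitK j); case: (fintype.split j)
    => i /=.
    by under eq_fun do rewrite row_mxEl; exact: (differentiable_rowP _ _).1.
  by under eq_fun do rewrite row_mxEr; exact: (differentiable_rowP _ _).1.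
apply/rowP => j; rewrite -derive_row// -(splitK j); case: (fintype.split j) =>
  i /=.
  rewrite [RHS]row_mxEl -derive_row//; congr ('D_v _ x).
  by apply/funext => y; rewrite row_mxEl.
rewrite [RHS]row_mxEr -derive_row//; congr ('D_v _ x).
by apply/funext => y; rewrite row_mxEr.
Qed.

End Derive.

Section DotDerive.
Context {R : realType} {V : normedModType R} {n : nat}.

Lemma dot_smooth (p w : V -> 'rV[R]_n) x : smooth_at p x -> smooth_at w x ->
  smooth_at (fun y => dot (p y) (w y)) x.
Proof.
by move=> pS wS; apply: smooth_at_sum => k; apply: smooth_atM; exact:
  smooth_at_coord.
Qed.

Lemma derive_dot (p w : V -> 'rV[R]_n) x v : differentiable p x ->
  differentiable w x ->
  'D_v (fun y => dot (p y) (w y)) x = dot ('D_v p x) (w x) + dot (p x) ('D_v w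
    x).
Proof.
move=> /differentiable_rowP dp /differentiable_rowP dw.
have -> : (fun y => dot (p y) (w y)) =
    \sum_k ((fun y => w y 0 k : R^o) * (fun y => p y 0 k : R^o)).
  by apply/funext => y; rewrite fct_sumE.
have dpk k : derivable (fun y => p y 0 k : R^o) x v by exact: diff_derivable.
have dwk k : derivable (fun y => w y 0 k : R^o) x v by exact: diff_derivable.
rewrite derive_sum; last by move=> k; exact: derivableM.
rewrite -big_split/=; apply: eq_bigr => k _.
rewrite deriveM// !derive_row; try exact/differentiable_rowP.
by congr (_ + _); exact: mulrC.
Qed.

End DotDerive.

Section Omega.
Context {R : realType} {n : nat} {Q : topologicalType} {AQ : atlas R n Q}.
Hypothesis SQ : smooth_atlas AQ.
Local Notation AT := (cotangent_atlas AQ).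
Local Notation cotangent := (cotangent R n Q).
Local Notation coordT i := (@coord R (n + n) cotangent AT i).
Local Notation paramT i := (@param R (n + n) cotangent AT i).
Implicit Types (i : chart_idx AQ) (q : Q) (a : cotangent).

Lemma fst_rep_near i a : dom i a.1 ->
  \forall x \near coordT i a, lsubmx x = (coord i \o fst \o paramT i a) x.
Proof.
move=> ia; apply: filterS (cotangent_near_param SQ ia) => x /= [ix Ex Ep].
by rewrite Ep /= Ex.
Qed.

Lemma fst_smooth a : smooth_map_at AT AQ fst a.
Proof.
have ia := atlas_dom_chart_at SQ a.1.
apply: (smooth_map_at_chart (cotangent_smooth_atlas SQ) SQ (i := chart_at AQ
  a.1) ia ia).
  by apply: filterS (cotangent_near_param SQ ia) => x /= [ix Ex ->].
apply: near_eq_smooth_at (fst_rep_near ia) _.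
exact/smooth_at_lsubmx/smooth_at_id.
Qed.

(** In every canonical chart the Liouville form is sum_k p_k dx^k, since the tangent map of the
    projection drops the momentum block. *)
Lemma liouville_chart i a w : dom i a.1 ->
  liouville AQ a (@from_chart _ _ _ AT i a w) = dot (rsubmx (coordT i a))
    (lsubmx w).
Proof.
move=> ia; rewrite liouvilleE_def.
have := @tmap_chart _ _ _ _ _ AT AQ (cotangent_smooth_atlas SQ) SQ fst a i i w
  (fst_smooth (a := a)) ia ia.
move=> E; apply: etrans (congr1 a.2 E) _.
rewrite cotangent_fromE; congr (dot _ _).
rewrite (diff_near_eq (fst_rep_near ia)); last exact: differentiable_lsubmx.
by rewrite diff_lin//; exact: continuous_lsubmx.
Qed.

(** This is sum_k dx^k /\ dp_k in the preferred chart. On a field with constant components w' the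
    Liouville form is p . w'_x, whose derivative along w is w_p . w'_x. *)
Lemma omegaQE a u v :
  omegaQ AQ a u v = dot (rsubmx v) (lsubmx u) - dot (rsubmx u) (lsubmx v).
Proof.
rewrite /omegaQ /ext_deriv.
have H w w' : 'D_w (fun x => liouville AQ (paramT (chart_at AQ a.1) a x)
    (@from_chart _ _ _ AT (chart_at AQ a.1) (paramT (chart_at AQ a.1) a x) w'))
    (coordT (chart_at AQ a.1) a) =
    dot (rsubmx w) (lsubmx w').
  have ia := atlas_dom_chart_at SQ a.1.
  transitivity ('D_w (fun x : 'rV[R]_(n + n) => dot (rsubmx x) (lsubmx w'))
    (coordT (chart_at AQ a.1) a)).
    apply: near_eq_derive.
    apply: filterS (cotangent_near_param SQ ia) => x /= [ix Ex Ep].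
    rewrite (liouville_chart w'); last by rewrite Ep.
    by rewrite Ep cotangent_coord_covector// row_mxKr.
  rewrite derive_dot ?derive_cst ?linear0 ?addr0; last 2 first.
    exact: differentiable_rsubmx.
    exact: differentiable_cst.
  by rewrite deriveE ?diff_lin//; [exact: continuous_rsubmx|exact:
    differentiable_rsubmx].
by rewrite [X in - (X - _)]H [X in - (_ - X)]H opprB.
Qed.

End Omega.

(** * The lifted action in coordinates *)

Section Slices.
Context {R : realType} {n k : nat} {M N : Type}.
Context {A : atlas R n M} {B : atlas R k N}.
Hypotheses (SA : smooth_atlas A) (SB : smooth_atlas B).

Lemma pairl_smooth (q : N) (p : M) : smooth_map_at A (prod_atlas A B) (fun p =>
  (p, q)) p.
Proof.
have [ip jq] := (atlas_dom_chart_at SA p, atlas_dom_chart_at SB q).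
apply: (smooth_map_at_chart SA (prod_smooth_atlas SA SB) (F := fun p => (p, q))
  (i := chart_at A p)
  (j := (chart_at A p, chart_at B q)) ip (conj ip jq)).
  by apply: filterS (near_param SA ip) => x [ix _].
apply: (@near_eq_smooth_at _ _ _ (fun x => row_mx x (coord (chart_at B q) q))).
  by apply: filterS (near_param SA ip) => x [_ /= ->].
exact/smooth_at_row_mx/smooth_at_cst/smooth_at_id.
Qed.

Lemma pairr_smooth (p : M) (q : N) : smooth_map_at B (prod_atlas A B) (pair p)
  q.
Proof.
have [ip jq] := (atlas_dom_chart_at SA p, atlas_dom_chart_at SB q).
apply: (smooth_map_at_chart SB (prod_smooth_atlas SA SB) (F := pair p) (i :=
  chart_at B q)
  (j := (chart_at A p, chart_at B q)) jq (conj ip jq)).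
  by apply: filterS (near_param SB jq) => x [ix _].
apply: (@near_eq_smooth_at _ _ _ (fun x => row_mx (coord (chart_at A p) p) x)).
  by apply: filterS (near_param SB jq) => x [_ /= ->].
apply: smooth_at_row_mx; [exact: smooth_at_cst|exact: smooth_at_id].
Qed.

End Slices.

Section Action.
Context {R : realType} {d n : nat} {G : topGroupType} {Q : topologicalType}.
Context {AG : atlas R d G} {AQ : atlas R n.+1 Q} {phi : G -> Q -> Q}.
Hypotheses (SG : smooth_atlas AG) (SQ : smooth_atlas AQ).
Hypothesis phi1 : forall q, phi 1%g q = q.
Hypothesis phiM : forall (g g' : G) q, phi (g * g')%g q = phi g (phi g' q).
Hypothesis phi_smooth : forall p,
  smooth_map_at (prod_atlas AG AQ) AQ (fun x => phi x.1 x.2) p.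
Hypothesis inv_smooth : forall g, smooth_map_at AG AG (fun g : G => g^-1)%g g.
Variable xi : 'rV[R]_d.
Local Notation cotangent := (cotangent R n.+1 Q).
Local Notation AT := (cotangent_atlas AQ).
Local Notation coordT i := (@coord R (n.+1 + n.+1) cotangent AT i).
Local Notation paramT i := (@param R (n.+1 + n.+1) cotangent AT i).
Local Notation cG := (chart_at AG 1%g).
Local Notation z0 := (coord cG 1%g).
Local Notation gen q := (generator AG AQ phi q).
Local Notation ghat := (generator_hat AQ AG phi xi).
Implicit Types (i : chart_idx AQ) (q : Q) (g : G) (a : cotangent).

Lemma orbit_smooth q g : smooth_map_at AG AQ (phi^~ q) g.
Proof.
apply: (smooth_map_at_comp SG (prod_smooth_atlas SG SQ) (F := pair^~ q)
  (F' := fun x => phi x.1 x.2)); first exact: pairl_smooth.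
exact: phi_smooth.
Qed.

Lemma translation_smooth g q : smooth_map_at AQ AQ (phi g) q.
Proof.
apply: (smooth_map_at_comp SQ (prod_smooth_atlas SG SQ) (F := pair g)
  (F' := fun x => phi x.1 x.2)); first exact: pairr_smooth.
exact: phi_smooth.
Qed.

Lemma inv_orbit_smooth q g : smooth_map_at AG AQ (fun g => phi g^-1%g q) g.
Proof.
apply: (smooth_map_at_comp SG SG (F := fun g => g^-1%g) (F' := phi^~ q)).
  exact: inv_smooth.
exact: orbit_smooth.
Qed.

(** The action near (1, q); the same chart i serves source and target because phi 1 q = q. *)
Definition action_rep i q : 'rV[R]_(d + n.+1) -> 'rV[R]_n.+1 :=
  coord i \o (fun x => phi x.1 x.2) \o @param _ _ _ (prod_atlas AG AQ) (cG, i)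
    (1%g, q).

Lemma action_rep_smooth i q : dom i q -> smooth_at (action_rep i q) (row_mx z0
  (coord i q)).
Proof.
move=> iq; apply: (phi_smooth (p := (1%g, q)) (i := (cG, i)) _ _).2.
  by split; first exact: atlas_dom_chart_at.
by rewrite phi1.
Qed.

Lemma action_repE i q : dom i q -> \forall w \near row_mx z0 (coord i q),
  action_rep i q w = coord i (phi (param AG cG 1%g (lsubmx w)) (param AQ i q
    (rsubmx w))).
Proof.
move=> iq.
have D : @dom _ _ _ (prod_atlas AG AQ) (cG, i) (1%g, q).
  by split; first exact: atlas_dom_chart_at.
by apply: filterS (prod_near_param SG SQ D) => w E; rewrite /action_rep /= E.
Qed.

(** The components of xi_Q in the chart i, written as a partial derivative of the action so that it
    can be interchanged with derivatives in x. *)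
Definition generator_rep i q (x : 'rV[R]_n.+1) : 'rV[R]_n.+1 :=
  'D_(row_mx xi 0) (action_rep i q) (row_mx z0 x).

Lemma generator_rep_smooth i q : dom i q -> smooth_at (generator_rep i q)
  (coord i q).
Proof.
move=> iq; apply: (@smooth_at_comp _ _ _ _ (row_mx z0) ('D_(row_mx xi 0)
  (action_rep i q))).
  by apply: smooth_at_row_mx; [exact: smooth_at_cst|exact: smooth_at_id].
exact/smooth_at_derive/action_rep_smooth.
Qed.

Lemma near_row_mxr m (z : 'rV[R]_m) (x : 'rV[R]_n.+1) (P : 'rV[R]_(m + n.+1) ->
  Prop) :
  (\forall w \near row_mx z x, P w) -> \forall y \near x, P (row_mx z y).
Proof.
apply: (@smooth_at_near_preimage _ _ _ (fun y => row_mx z y)).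
by apply: smooth_at_row_mx; [exact: smooth_at_cst|exact: smooth_at_id].
Qed.

Lemma near_row_mxl m (z : 'rV[R]_m) (x : 'rV[R]_n.+1) (P : 'rV[R]_(m + n.+1) ->
  Prop) :
  (\forall w \near row_mx z x, P w) -> \forall y \near z, P (row_mx y x).
Proof.
apply: (@smooth_at_near_preimage _ _ _ (fun y => row_mx y x)).
by apply: smooth_at_row_mx; [exact: smooth_at_id|exact: smooth_at_cst].
Qed.

Lemma generatorE i q : dom i q -> \forall x \near coord i q,
  gen (param AQ i q x) xi = from_chart i (param AQ i q x) (generator_rep i q x).
Proof.
move=> iq.
(* [near_join] is required since the formula for the action is differentiated in z: it must hold
   around each [row_mx z0 x], not only there. *)
have n1 := near_row_mxr (near_join (action_repE iq)).
have n2 := near_row_mxr (smooth_at_near (action_rep_smooth iq)).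
apply: filterS3 (near_param SQ iq) n1 n2 => x [ix Ex] Px Sx.
set q' := param AQ i q x in ix Ex *.
have ix' : dom i (phi 1%g q') by rewrite phi1.
have := tmap_chart SG SQ xi (orbit_smooth (q := q') (g := 1%g))
  (atlas_dom_chart_at SG 1%g) ix'.
rewrite (from_chart_at SG) [in from_chart i _]phi1 => E; apply: etrans E _.
congr (from_chart i q' _).
have [_ S] := orbit_smooth (atlas_dom_chart_at SG 1%g) ix'.
rewrite -(deriveE _ (smooth_at_diff S)) /generator_rep -derive_row_mxl.
apply: near_eq_derive.
apply: filterS (near_row_mxl Px) => z ->.
by rewrite row_mxKl row_mxKr.
Qed.

Lemma ghatE i a : dom i a.1 -> \forall x \near coordT i a,
  dot (rsubmx x) (generator_rep i a.1 (lsubmx x)) = (ghat \o paramT i a) x.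
Proof.
move=> ia.
have n1 : \forall y \near lsubmx (coordT i a),
    gen (param AQ i a.1 y) xi = from_chart i (param AQ i a.1 y) (generator_rep
    i a.1 y).
  by rewrite /= row_mxKl; exact: generatorE.
apply: filterS2 (near_lsubmx n1) (cotangent_near_param SQ ia) => x E [ix Ex Ep].
rewrite [RHS]/comp Ep /generator_hat [X in _ = _ X]E.
by rewrite [RHS](covectorE SQ).
Qed.

Lemma ghat_rep_smooth i a : dom i a.1 ->
  smooth_at (fun x => dot (rsubmx x) (generator_rep i a.1 (lsubmx x))) (coordT
    i a).
Proof.
move=> ia; apply: dot_smooth; first exact/smooth_at_rsubmx/smooth_at_id.
apply: (@smooth_at_comp _ _ _ _ lsubmx (generator_rep i a.1)).
  exact/smooth_at_lsubmx/smooth_at_id.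
by rewrite /= row_mxKl; exact: generator_rep_smooth.
Qed.

Lemma ghat_smooth a : smooth_fun_at AT ghat a.
Proof.
have ia := atlas_dom_chart_at SQ a.1.
apply: (smooth_fun_at_chart (cotangent_smooth_atlas SQ) (i := chart_at AQ a.1)
  ia).
exact: near_eq_smooth_at (ghatE ia) (ghat_rep_smooth ia).
Qed.

Lemma dfun_ghat a u (i := chart_at AQ a.1) : dfun AT ghat a u =
  dot (rsubmx u) (generator_rep i a.1 (coord i a.1)) +
  dot (rsubmx (coordT i a)) ('D_(lsubmx u) (generator_rep i a.1) (coord i a.1)).
Proof.
have ia : dom i a.1 by exact: (atlas_dom_chart_at SQ).
have ST := cotangent_smooth_atlas SQ.
rewrite -[in LHS](from_chart_at ST a u).
apply: etrans (dfun_chart ST u (ghat_smooth (a := a)) (i := i) ia) _.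
rewrite (@diff_near_eq _ _ R^o _ _ _ (ghatE ia)); last
  exact/smooth_at_diff/ghat_rep_smooth.
rewrite -deriveE; last exact/smooth_at_diff/ghat_rep_smooth.
have lS : smooth_at (@lsubmx R 1 n.+1 n.+1) (coordT i a) by
  exact/smooth_at_lsubmx/smooth_at_id.
have gS : smooth_at (generator_rep i a.1) (lsubmx (coordT i a)).
  by rewrite /= row_mxKl; exact: generator_rep_smooth.
rewrite derive_dot; last 2 first.
- exact: differentiable_rsubmx.
- exact/smooth_at_diff/(smooth_at_comp lS gS).
rewrite (deriveE _ (@differentiable_rsubmx _ _ _ _ _)) diff_lin; last exact:
  continuous_rsubmx.
rewrite (@derive_comp _ _ _ _ lsubmx _ _ u (smooth_at_diff lS) (smooth_at_diff
  gS)).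
rewrite (deriveE _ (@differentiable_lsubmx _ _ _ _ _)) diff_lin; last exact:
  continuous_lsubmx.
by rewrite -(deriveE _ (smooth_at_diff gS)) row_mxKl.
Qed.

(** * The curve of inverse lifts through a covector *)

Section Curve.
Variable a : cotangent.
Local Notation q0 := a.1.
Local Notation i := (chart_at AQ a.1).
Local Notation x0 := (coord i q0).
Local Notation p0 := (rsubmx (coordT i a)).

Let i0 : dom i q0. Proof. exact: (atlas_dom_chart_at SQ). Qed.
Let c1 : dom cG 1%g. Proof. exact: (atlas_dom_chart_at SG). Qed.

(** With g^-1 as group element, the covector part is a o T phi_g at the point phi_{g^-1}(q0). *)
Definition inverse_lift (g : G) : cotangent := cotangent_lift AQ phi g^-1%g a.

Let inv1 : phi 1^-1%g q0 = q0. Proof. by rewrite invg1 phi1. Qed.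

Lemma inverse_lift1 : inverse_lift 1%g = a.
Proof.
rewrite /inverse_lift /cotangent_lift invgK inv1 [RHS]surjective_pairing; congr
  pair.
have -> : phi 1%g = id by apply/funext => q; exact: phi1.
by apply/lfunP => v; rewrite comp_lfunE (tmap_id SQ).
Qed.

Let Phi : 'rV[R]_d -> 'rV[R]_n.+1 := coord i \o (fun g => phi g^-1%g q0) \o
  param AG cG 1%g.

Let Phi_smooth : smooth_at Phi z0.
Proof. by apply: (inv_orbit_smooth (q := q0) (g := 1%g) c1 _).2; rewrite inv1.
  Qed.

Let Phi_z0 : Phi z0 = x0.
Proof. by rewrite /Phi /= (param_coord SG)// inv1. Qed.

Let near_PhiE : \forall z \near z0,
  let q := phi (param AG cG 1%g z)^-1%g q0 in
  [/\ dom i q, coord i q = Phi z, param AQ i q0 (Phi z) = q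
    & phi (param AG cG 1%g z) q = q0].
Proof.
have i1 : dom i (phi 1^-1%g q0) by rewrite inv1.
apply: filterS (inv_orbit_smooth (q := q0) (g := 1%g) c1 i1).1 => z iz; split
  => //.
  exact: (param_coord SQ).
by rewrite -phiM mulgV phi1.
Qed.

Let near_Phi (P : 'rV[R]_(d + n.+1) -> Prop) :
  (\forall w \near row_mx z0 x0, P w) -> \forall z \near z0, P (row_mx z (Phi
    z)).
Proof.
rewrite -Phi_z0; apply: (@smooth_at_near_preimage _ _ _ (fun z => row_mx z (Phi
  z))).
by apply: smooth_at_row_mx => //; exact: smooth_at_id.
Qed.

Let Psi := action_rep i q0.

Let Psi_smooth : smooth_at Psi (row_mx z0 x0).
Proof. exact: action_rep_smooth. Qed.

Let Psi_Phi : \forall z \near z0, Psi (row_mx z (Phi z)) = x0.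
Proof.
apply: filterS2 near_PhiE (near_Phi (action_repE i0)) => z [_ _ Eq Ephi].
by rewrite row_mxKl row_mxKr Eq Ephi.
Qed.

Let Psi_z0 : \forall x \near x0, Psi (row_mx z0 x) = x.
Proof.
apply: filterS2 (near_param SQ i0) (near_row_mxr (action_repE i0)) => x [_ Ex].
by rewrite row_mxKl row_mxKr (param_coord SG)// phi1 Ex.
Qed.

Let derive_Psi_z0 v : 'D_(row_mx 0 v) Psi (row_mx z0 x0) = v.
Proof.
by rewrite -derive_row_mxr (@near_eq_derive _ _ _ _ id) ?derive_id.
Qed.

(** Differentiate Psi(z, Phi z) = x0 along xi: the partial derivative in z is the generator, and the
    one in x is the identity because Psi(z0, .) is the identity near x0. *)
Let derive_Phi : 'D_xi Phi z0 = - generator_rep i q0 x0.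
Proof.
have idS : smooth_at (id : 'rV[R]_d -> 'rV[R]_d) z0 by exact: smooth_at_id.
have pS := smooth_at_row_mx idS Phi_smooth.
have E : 'D_xi (Psi \o (fun z => row_mx z (Phi z))) z0 = 0.
  by rewrite (@near_eq_derive _ _ _ _ (cst x0)) ?derive_cst//; exact: Psi_Phi.
have PS : smooth_at Psi (row_mx z0 (Phi z0)) by rewrite Phi_z0.
rewrite (derive_comp _ (smooth_at_diff pS) (smooth_at_diff PS)) in E.
rewrite -(deriveE _ (smooth_at_diff PS)) in E.
rewrite (derive_row_mx _ (smooth_at_diff idS) (smooth_at_diff Phi_smooth))
  derive_id Phi_z0 in E.
have Er : row_mx xi ('D_xi Phi z0) = row_mx xi 0 + row_mx 0 ('D_xi Phi z0).
  by rewrite add_row_mx addr0 add0r.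
rewrite Er (deriveDdir _ _ (smooth_at_diff Psi_smooth)) derive_Psi_z0 in E.
by apply/eqP; rewrite -addr_eq0 addrC; apply/eqP.
Qed.

(** The k-th momentum of the curve, a(T phi_g(d/dx^k)) at phi_{g^-1}(q0); T phi_g ends at q0, where
    the momenta of a are [p0]. *)
Let mom k (z : 'rV[R]_d) : R^o :=
  dot p0 ('D_(row_mx 0 (delta_mx 0 k)) Psi (row_mx z (Phi z))).

Let rowPhi_smooth : smooth_at (fun z => row_mx z (Phi z)) z0.
Proof. by apply: smooth_at_row_mx => //; exact: smooth_at_id. Qed.

Let DPsi_smooth k :
  smooth_at (fun z => 'D_(row_mx 0 (delta_mx 0 k)) Psi (row_mx z (Phi z))) z0.
Proof.
apply: (@smooth_at_comp _ _ _ _ (fun z => row_mx z (Phi z))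
  ('D_(row_mx 0 (delta_mx 0 k)) Psi) _ rowPhi_smooth).
by apply: smooth_at_derive; rewrite Phi_z0.
Qed.

Let near_inverse_lift : \forall z \near z0,
  row_mx (Phi z) (\row_k mom k z) = (coordT i \o inverse_lift \o param AG cG
    1%g) z.
Proof.
apply: filterS2 near_PhiE (near_Phi (near_join (action_repE i0))) => z [iz Ez
  Eq Ephi] nP.
rewrite [RHS]/=; congr row_mx; apply/rowP => k; rewrite [LHS]mxE [RHS]mxE.
rewrite comp_lfunE invgK coord_vectorE.
set g := param AG cG 1%g z in iz Ez Eq Ephi *; set q := phi g^-1%g q0 in iz Ez
  Eq Ephi *.
have ig : dom i (phi g q) by rewrite Ephi.
have := tmap_chart SQ SQ (delta_mx 0 k) (translation_smooth (g := g) (q := q))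
  iz ig.
rewrite [X in _ = from_chart i X _]Ephi => E; rewrite [X in a.2 X]E
  cotangent_fromE /mom.
congr (dot _ _).
have [_ S] := translation_smooth (g := g) (q := q) iz ig.
rewrite -(deriveE _ (smooth_at_diff S)) Ez -derive_row_mxr.
apply: near_eq_derive.
have nb := near_param_base SQ iz; rewrite Ez in nb.
apply: filterS2 nb (near_row_mxr nP) => x Ex Px.
by rewrite /Psi Px row_mxKl row_mxKr /= (Ex q0).
Qed.

Lemma inverse_lift_smooth : smooth_map_at AG AT inverse_lift 1%g.
Proof.
have ST := cotangent_smooth_atlas SQ.
have iA : @dom _ _ _ AT i (inverse_lift 1%g) by rewrite inverse_lift1.
apply: (smooth_map_at_chart SG ST c1 iA).
  by apply: filterS near_PhiE => z [].
apply: near_eq_smooth_at near_inverse_lift _.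
apply: smooth_at_row_mx => //; apply/smooth_at_rowP => k.
apply: (@near_eq_smooth_at _ _ _ (mom k)); first by near=> z; rewrite mxE.
by apply: dot_smooth; [exact: smooth_at_cst|exact: DPsi_smooth].
Unshelve. all: by end_near. Qed.

(* Symmetry of the second derivatives turns d/dt D_x into D_x d/dt. *)
Let derive_mom k :
  'D_xi (mom k) z0 = dot p0 ('D_(delta_mx 0 k) (generator_rep i q0) x0).
Proof.
set e : 'rV[R]_n.+1 := delta_mx 0 k.
rewrite /mom (derive_dot _ (@differentiable_cst _ _ _ _ _) (smooth_at_diff
  (DPsi_smooth k))).
rewrite derive_cst dot0l add0r; apply: (congr1 (dot p0)).
have idS : smooth_at (id : 'rV[R]_d -> 'rV[R]_d) z0 by exact: smooth_at_id.
have DS : smooth_at ('D_(row_mx 0 e) Psi) (row_mx z0 (Phi z0)).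
  by apply: smooth_at_derive; rewrite Phi_z0.
rewrite (@derive_comp _ _ _ _ (fun z => row_mx z (Phi z)) _ _ _ (smooth_at_diff
  rowPhi_smooth) (smooth_at_diff DS)).
rewrite -(deriveE _ (smooth_at_diff DS)).
rewrite (derive_row_mx _ (smooth_at_diff idS) (smooth_at_diff Phi_smooth))
  derive_id Phi_z0.
set u := 'D_xi Phi z0.
transitivity ('D_(row_mx 0 e) ('D_(row_mx xi u) Psi) (row_mx z0 x0)).
  exact: derive_comm_row.
rewrite -derive_row_mxr.
(* Near x0 the map Psi(z0, .) is the identity, so the derivative of Psi along (xi, u) at (z0, x) is
   the generator at x plus u; the constant u then disappears under 'D_e. *)
transitivity ('D_e (fun x => generator_rep i q0 x + u) x0).
  apply: near_eq_derive.
  apply: filterS2 (near_row_mxr (smooth_at_near Psi_smooth)) (near_join Psi_z0)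
    => x Sx nx.
  have -> : row_mx xi u = row_mx xi 0 + row_mx 0 u by rewrite add_row_mx addr0
    add0r.
  rewrite (deriveDdir _ _ (smooth_at_diff Sx)); congr (_ + _).
  by rewrite -derive_row_mxr (@near_eq_derive _ _ _ _ id) ?derive_id.
have gd : derivable (generator_rep i q0) x0 e.
  exact/diff_derivable/smooth_at_diff/generator_rep_smooth.
by rewrite (deriveD gd (derivable_cst _ _ _)) derive_cst addr0.
Qed.

(** For H = p . X with X the generator, this is (-dH/dp, dH/dx): the opposite of the Hamiltonian
    vector field of H. *)
Lemma tmap_inverse_lift : tmap AG AT inverse_lift 1%g xi =
  row_mx (- generator_rep i q0 x0)
    (\row_k dot p0 ('D_(delta_mx 0 k) (generator_rep i q0) x0)).
Proof.
have ST := cotangent_smooth_atlas SQ.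
have iA : @dom _ _ _ AT i (inverse_lift 1%g) by rewrite inverse_lift1.
have := tmap_chart SG ST xi inverse_lift_smooth c1 iA.
rewrite (from_chart_at SG) => E; apply: etrans E _.
rewrite [in from_chart _ _]inverse_lift1.
apply: etrans (from_chart_at ST a _) _.
have momS : smooth_at (fun z => \row_k mom k z) z0.
  apply/smooth_at_rowP => k.
  apply: (@near_eq_smooth_at _ _ _ (mom k)); first by near=> z; rewrite mxE.
  by apply: dot_smooth; [exact: smooth_at_cst|exact: DPsi_smooth].
have RS := smooth_at_diff (smooth_at_row_mx Phi_smooth momS).
rewrite (diff_near_eq near_inverse_lift RS) -(deriveE _ RS).
rewrite (derive_row_mx _ (smooth_at_diff Phi_smooth) (smooth_at_diff momS))
  derive_Phi.
congr row_mx; apply/rowP => k; rewrite [RHS]mxE -derive_mom -derive_row; last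
  exact: smooth_at_diff.
by congr ('D_xi _ z0); apply/funext => z; rewrite mxE.
Unshelve. all: by end_near. Qed.

(** The opposite sign of the inverse lift is absorbed by placing it in the second argument of the
    symplectic form. *)
Lemma omegaQ_inverse_lift u :
  omegaQ AQ a u (tmap AG AT inverse_lift 1%g xi) = dfun AT ghat a u.
Proof.
rewrite (omegaQE SQ) dfun_ghat tmap_inverse_lift row_mxKl row_mxKr.
rewrite addrC linearN opprK; congr (_ + _).
set X := generator_rep i q0; have XS : smooth_at X x0 by exact:
  generator_rep_smooth.
rewrite (deriveE _ (smooth_at_diff XS)) diff_rowE; last exact: smooth_at_diff.
rewrite linear_sum /dot; apply: eq_bigr => k _.
by rewrite [in RHS]linearZ [X in _ * X = _]mxE.
Qed.

End Curve.

End Action.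

(** * Invariance of the momentum *)

(** A ball contains the segment from its centre to each of its points, and the mean value theorem
    applies along that segment. *)
Lemma near_derive0_const (R : realType) (V : normedModType R) (f : V -> R^o) (x
  : V) :
  (\forall y \near x, differentiable f y /\ forall v, 'D_v f y = 0) ->
  \forall y \near x, f y = f x.
Proof.
move=> /nbhs_ballP[e /= e0 He]; apply/nbhs_ballP; exists e => //= y.
rewrite -ball_normE/= distrC => yx.
have inb (s : R) : 0 <= s <= 1 -> ball x e (s *: (y - x) + x).
  move=> /andP[s0 s1]; rewrite -ball_normE/= opprD addrCA subrr addr0 normrN.
  by rewrite normrZ ger0_norm// (le_lt_trans _ yx)// ler_piMl.
have fD (s : R) : 0 <= s <= 1 ->
    is_derive s (1 : R) (fun s : R => f (s *: (y - x) + x)) 0.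
  by move=> /inb/He[df E]; have := is_derive_line df; rewrite E.
have [] := @MVT R (fun s : R => f (s *: (y - x) + x)) (fun=> 0) 0 1 ltr01.
- by move=> s; rewrite in_itv/= => /andP[s0 s1]; apply: fD; rewrite !ltW.
- apply: derivable_within_continuous => s; rewrite in_itv/= => /fD fs.
  exact: ex_derive.
move=> s _; rewrite mul0r scale1r scale0r add0r subrK => /eqP.
by rewrite subr_eq0 => /eqP.
Qed.

(** * Functions with zero differential on a connected manifold *)

Section ManifoldFunctions.
Context {R : realType} {n : nat} {M : topologicalType} {A : atlas R n M}.
Hypothesis mA : is_manifold A.
Let SA := manifold_smooth_atlas mA.

Lemma near_coord (i : chart_idx A) p (P : 'rV[R]_n -> Prop) : dom i p ->
  (\forall x \near coord i p, P x) -> \forall q \near p, P (coord i q).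
Proof.
move=> ip nP; have : {within dom i, continuous (coord i)} by exact:
  (coord_continuous mA).
rewrite continuous_open_subspace; last exact: (dom_open mA).
move=> /(_ p); rewrite inE => /(_ ip) c; exact: (c P nP).
Qed.

Lemma dfun0_locally_const (f : M -> R) p :
  (forall p, smooth_fun_at A f p) -> (forall p v, dfun A f p v = 0) ->
  \forall q \near p, f q = f p.
Proof.
move=> fS f0; have ip := atlas_dom_chart_at SA p.
set i := chart_at A p in ip *.
have nD : \forall x \near coord i p,
    differentiable (f \o param A i p : 'rV[R]_n -> R^o) x /\
    forall v, 'D_v (f \o param A i p : 'rV[R]_n -> R^o) x = 0.
  apply: filterS2 (smooth_at_near (fS p i ip)) (dfun_chart_near SA fS ip) => x
    Sx Dx.
  by split=> [|v]; [exact: smooth_at_diff|rewrite -Dx f0].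
have iN : nbhs p (dom i) by apply: open_nbhs_nbhs; split=> //; exact: (dom_open
  mA).
apply: filterS2 iN (near_coord ip (near_derive0_const nD)) => q iq /=.
by rewrite !(param_coord SA).
Qed.

(** A locally constant function has open preimages of all sets, so each level set is open and
    closed. *)
Lemma connected_dfun0_const (f : M -> R) : connected [set: M] ->
  (forall p, smooth_fun_at A f p) -> (forall p v, dfun A f p v = 0) ->
  forall p q, f p = f q.
Proof.
move=> cM fS f0 p q.
have op (S : set R) : open (f @^-1` S).
  rewrite openE => r /= Sr; apply: filterS (dfun0_locally_const r fS f0) => r'
    /= ->.
  exact: Sr.
suff E : f @^-1` [set f p] = [set: M].
  have : (f @^-1` [set f p]) q by rewrite E.
  by move=> /= ->.
apply: cM; first by exists p.
  by exists (f @^-1` [set f p]); [exact: op|rewrite setTI].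
exists (f @^-1` [set f p]); last by rewrite setTI.
by rewrite -[X in closed X]setCK preimage_setC; apply/open_closedC/op.
Qed.

End ManifoldFunctions.

Lemma dfunB (R : realType) n (M : Type) (A : atlas R n M) (f g : M -> R) p v :
  smooth_atlas A -> smooth_fun_at A f p -> smooth_fun_at A g p ->
  dfun A (fun q => f q - g q) p v = dfun A f p v - dfun A g p v.
Proof.
move=> SA fS gS; have ip := atlas_dom_chart_at SA p.
have E1 := dfunE A (fun q => f q - g q) p v.
have E2 := dfunE A f p v; have E3 := dfunE A g p v.
have E4 := congr1 (fun F => F v) (diffB (smooth_at_diff (fS _ ip))
  (smooth_at_diff (gS _ ip))).
exact: etrans E1 (etrans E4 (congr2 (fun x y => x - y) (esym E2) (esym E3))).
Qed.

Lemma smooth_fun_atB (R : realType) n (M : Type) (A : atlas R n M) (f g : M ->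
  R) p :
  smooth_fun_at A f p -> smooth_fun_at A g p -> smooth_fun_at A (fun q => f q -
    g q) p.
Proof. by move=> fS gS i ip; exact: smooth_atB (fS i ip) (gS i ip). Qed.

Lemma smooth_fun_at_cst (R : realType) n (M : Type) (A : atlas R n M) (c : R) p
  :
  smooth_fun_at A (fun=> c) p.
Proof. by move=> i ip; exact: smooth_at_cst. Qed.

Lemma dfun_cst (R : realType) n (M : Type) (A : atlas R n M) (c : R) p v :
  dfun A (fun=> c) p v = 0.
Proof.
by rewrite dfunE [_ \o _](_ : _ = cst c) ?diff_cst//; apply/funext.
Qed.

Theorem theorem4p7 (R : realType) (n d : nat)
    (Q : topologicalType) (AQ : atlas R n.+1 Q) (Pi : Q -> R)
    (G : topGroupType) (AG : atlas R d G) (phi : G -> Q -> Q)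
    (h : vdual AQ Pi -> cotangent R n.+1 Q)
    (manifold_Q : is_manifold AQ) (connected_Q : connected [set: Q])
    (fibration_Pi : is_fibration AQ Pi)
    (lie_G : is_lie_group AG)
    (action_phi : is_smooth_action AG AQ phi)
    (free_phi : free_action phi) (proper_phi : proper_action phi)
    (invariant_eta : eta_invariant AQ Pi phi)
    (section_h : hamiltonian_section h)
    (equivariant_h : equivariant_section phi h)
    (xi : 'rV[R]_d) :
  let f := fun a => generator_hat AQ AG phi xi a
                    - cphi Pi AG phi xi * ext_hamiltonian h a in
  let JVxi := fun b => momentumV AG phi h b xi in
  [/\ smooth_fun (cotangent_atlas AQ) f,
      mu_basic AQ Pi f,
      (forall f' : vdual AQ Pi -> R, f = f' \o mu AQ Pi -> f' = JVxi)
    & forall X : vdual AQ Pi -> 'rV[R]_(n.+1 + n),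
        is_hamiltonian_dynamics h X ->
        forall b, dfun (vdual_atlas AQ Pi) JVxi b (X b) = 0].
Proof.
move=> f JVxi.
have SQ := manifold_smooth_atlas manifold_Q.
have SG := manifold_smooth_atlas (lie_group_manifold lie_G).
have ST := cotangent_smooth_atlas SQ.
have SPi : forall q, smooth_fun_at AQ Pi q.
  exact: (smooth_funP SQ _).1 (fibration_smooth fibration_Pi).
have sub := fibration_submersion fibration_Pi.
have SV := vdual_smooth_atlas SQ SPi sub.
have muS := mu_smooth SQ SPi sub.
have phi1 := action1 action_phi.
have phiM := actionM action_phi.
have phiS := smooth_mapP (prod_smooth_atlas SG SQ) SQ (action_smooth
  action_phi).
have invS := smooth_mapP SG SG (lie_group_inv lie_G).
have [hS0 muh] := section_h.
have hS := smooth_mapP SV ST hS0.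
set ghat := generator_hat AQ AG phi xi.
have ghatS : forall a, smooth_fun_at (cotangent_atlas AQ) ghat a.
  exact: (ghat_smooth SG SQ phi1 phiS xi).
(* Invariance of eta says that Pi o phi_g - Pi has zero differential; as Q is connected it is a
   constant s, so [xget] returns a true shift rather than its default 0. *)
have time_shiftE q g : time_shift Pi phi g = Pi (phi g q) - Pi q.
  have [s sE] : exists s, forall q, Pi (phi g q) = Pi q + s.
    exists (Pi (phi g q) - Pi q) => q'.
    have gS r : smooth_map_at AQ AQ (phi g) r by exact: (translation_smooth SG
    SQ phiS).
    have PgS r : smooth_fun_at AQ (Pi \o phi g) r.
      exact: (smooth_fun_at_comp SQ SQ (gS r) (SPi (phi g r))).
    have FS r : smooth_fun_at AQ (fun r => (Pi \o phi g) r - Pi r) r.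
      exact: smooth_fun_atB (PgS r) (SPi r).
    have F0 r v : dfun AQ (fun r => (Pi \o phi g) r - Pi r) r v = 0.
      apply: etrans (dfunB v SQ (PgS r) (SPi r)) _.
      have E1 := dfun_comp SQ SQ v (gS r) (SPi (phi g r)).
      have E2 := congr1 (fun F : 'Hom(_, _) => F v) (invariant_eta g r).
      rewrite comp_lfunE in E2.
      by apply/eqP; rewrite subr_eq0; apply/eqP; exact: etrans E1 E2.
    have E : Pi (phi g q') - Pi q' = Pi (phi g q) - Pi q.
      exact: (connected_dfun0_const manifold_Q connected_Q FS F0 q' q).
    by rewrite -E addrCA subrr addr0.
  have := @xgetPex _ 0 [set s | forall q, Pi (phi g q) = Pi q + s] (ex_intro _
    s sE).
  by rewrite -/(time_shift Pi phi g) => /(_ q) ->; rewrite addrAC subrr add0r.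
(* For fixed q the function m is g |-> Pi(phi_g(q)) - Pi(q), and the chain rule at the unit gives
   its differential. *)
have cphiE q : cphi Pi AG phi xi = eta AQ Pi q (generator AG AQ phi q xi).
  have -> : cphi Pi AG phi xi = dfun AG (fun g => (Pi \o phi^~ q) g - Pi q) 1%g
    xi.
    by congr (dfun AG _ 1%g xi); apply/funext => g; exact: time_shiftE.
  have oS : smooth_map_at AG AQ (phi^~ q) 1%g by exact: (orbit_smooth SG SQ
    phiS).
  have PoS := smooth_fun_at_comp SG SQ oS (SPi (phi 1%g q)).
  have cS : smooth_fun_at AG (fun=> Pi q) 1%g by exact: smooth_fun_at_cst.
  apply: etrans (dfunB xi SG PoS cS) _.
  apply: etrans (congr2 (fun x y => x - y) (dfun_comp SG SQ xi oS (SPi (phi 1%g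
    q)))
    (dfun_cst AG (Pi q) 1%g xi)) _.
  by rewrite subr0 phi1.
have hbase b : (h b).1 = tau b := congr1 (@tau _ _ _ _ _) (muh b).
have ext_hamE a : a.2 - (h (mu AQ Pi a)).2 = ext_hamiltonian h a *: eta AQ Pi
  a.1.
  have [s sE] := mu_eq_eta sub (esym (muh (mu AQ Pi a))).
  exact: (@xgetPex _ 0 [set s | a.2 - (h (mu AQ Pi a)).2 = s *: eta AQ Pi a.1]
    (ex_intro _ s sE)).
have fE a : f a = ghat (h (mu AQ Pi a)).
  have := congr1 (fun F : 'Hom(_, _) => F (generator AG AQ phi a.1 xi))
    (ext_hamE a).
  rewrite add_lfunE opp_lfunE scale_lfunE -cphiE => E.
  rewrite /f /ghat /generator_hat (hbase (mu AQ Pi a)).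
  have aux (x y s c : R) : x - y = s * c -> x - c * s = y by move=> ?; lra.
  exact: aux E.
(* [h b] shows that the fibre of mu over b is inhabited, so [xget] picks a point of it; which one is
   irrelevant because f factors through mu. *)
have f_uniq f' : f = f' \o mu AQ Pi -> f' = JVxi.
  move=> E; apply/funext => b.
  have Eb : mu AQ Pi (xget (tau b, 0) [set a | mu AQ Pi a = b]) = b.
    exact: (@xgetPex _ (tau b, 0) [set a | mu AQ Pi a = b] (ex_intro _ _ (muh
    b))).
  rewrite -[in LHS]Eb -[LHS]/((f' \o mu AQ Pi) _) -E /f /JVxi /momentumV
    /momentum.
  by rewrite add_lfunE opp_lfunE scale_lfunE comp_lfunE [_ *: _]mulrC.
have fE' : f = (ghat \o h) \o mu AQ Pi by apply/funext.
have JE := f_uniq _ fE'.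
have ghS b : smooth_fun_at (vdual_atlas AQ Pi) (ghat \o h) b.
  exact: (smooth_fun_at_comp SV ST (hS b) (ghatS (h b))).
split=> //.
- apply: (smooth_funP ST _).2 => a; rewrite fE'.
  exact: (smooth_fun_at_comp ST SV (muS a) (ghS _)).
- by exists (ghat \o h) => //; exact: (smooth_funP SV _).2.
move=> X XD b; rewrite -JE.
rewrite (dfun_comp SV ST (X b) (hS b) (ghatS (h b))).
rewrite -(omegaQ_inverse_lift SG SQ phi1 phiM phiS invS xi (h b)).
set A := inverse_lift (AQ := AQ) (phi := phi) (h b).
have A1 : A 1%g = h b by exact: (inverse_lift1 SQ phi1).
have AS : smooth_map_at AG (cotangent_atlas AQ) A 1%g.
  exact: (inverse_lift_smooth SG SQ phi1 phiM phiS invS).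
(* Equivariance gives A(g) = h(b'), where b' is the lifted action of g^-1 on b, and mu recovers b'
   from h(b'). Thus mu o A is an orbit curve in V^*Pi with smoothness already at hand. *)
have AE : A = h \o (mu AQ Pi \o A).
  apply/funext => g; rewrite /A /inverse_lift equivariant_h.
  by rewrite /= equivariant_h muh.
have mA1 : mu AQ Pi (A 1%g) = b by rewrite A1 muh.
have -> : tmap AG (cotangent_atlas AQ) A 1%g xi =
    tmap (vdual_atlas AQ Pi) (cotangent_atlas AQ) h b
      (tmap AG (vdual_atlas AQ Pi) (mu AQ Pi \o A) 1%g xi).
  rewrite [in LHS]AE -[in RHS]mA1.
  apply: (tmap_comp SG SV ST); last exact: hS.
  exact: (smooth_map_at_comp SG ST AS (muS (A 1%g))).
exact: (dynamics_Omega XD b).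
Qed.
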